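(* Let $f_0:\mathbb{R}^{p+1}\to\mathbb{A}$ be a polynomial. Then $$CK[f_0](\mathbf{x})=\sum_{k\ge0}\frac{r^{2k}}{(2k)!}(-\Delta_{\mathbf{x}_p})^kf_0(\mathbf{x}_p)+\underline{\omega}\sum_{k\ge0}\frac{r^{2k+1}}{(2k+1)!}(-\Delta_{\mathbf{x}_p})^k\big(D_{\mathbf{x}_p}f_0(\mathbf{x}_p)\big),\quad \mathbf{x}=\mathbf{x}_p+r\underline{\omega}\in M,$$ (a finite sum) is the unique extension of $f_0$ to $M$ which is (left) generalized partial-slice monogenic of type $(p,q)$.
   Context: Let $\mathbb{A}$ be a real alternative algebra (the associator $[a,b,c]=(ab)c-a(bc)$ is an alternating trilinear function) with unity $1$, of finite real dimension $d>1$, equipped with an anti-involution $a\mapsto a^c$ (real linear, $a^c=a$ for real $a$, $(a^c)^c=a$, $(ab)^c=b^ca^c$). Let $t(x)=x+x^c$, $n(x)=xx^c$, $\mathbb{S}_{\mathbb{A}}=\{x: t(x)=0,\ n(x)=1\}$ (assumed nonempty) and $Q_{\mathbb{A}}=\mathbb{R}\cup\{x: t(x)\in\mathbb{R},\ n(x)\in\mathbb{R},\ 4n(x)>t(x)^2\}$. Let $M$ be a real subspace with $\mathbb{R}\subsetneq M\subseteq Q_{\mathbb{A}}$ having a basis $(v_0,\dots,v_m)$, $m\ge1$, $v_0=1$, $v_s\in\mathbb{S}_{\mathbb{A}}$, $v_sv_t=-v_tv_s$ for distinct $s,t\ge1$; complete it to a basis of $\mathbb{A}$ with associated Euclidean norm.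 Identify $x=\sum x_sv_s\in M$ with $(x_0,\dots,x_m)\in\mathbb{R}^{m+1}$; differentiate componentwise. Fix $p\in\{0,\dots,m-1\}$, $q=m-p$; $\mathbf{x}=\mathbf{x}_p+\underline{\mathbf{x}}_q$ with $\mathbf{x}_p=\sum_{s=0}^px_sv_s\in\mathbb{R}^{p+1}$, $\underline{\mathbf{x}}_q=\sum_{s=p+1}^m x_sv_s$; $\mathbb{S}=\{\sum_{s=p+1}^m x_sv_s:\sum x_s^2=1\}$; $\underline{\mathbf{x}}_q=r\underline{\omega}$ with $r=|\underline{\mathbf{x}}_q|$, $\underline{\omega}\in\mathbb{S}$. $D_{\mathbf{x}_p}f=\sum_{s=0}^p v_s\partial_{x_s}f$, $\Delta_{\mathbf{x}_p}=\sum_{s=0}^p\partial_{x_s}^2$. A function $f:\Omega\to\mathbb{A}$ ($\Omega\subseteq M$ open) is left generalized partial-slice monogenic of type $(p,q)$ if for every $\underline{\omega}\in\mathbb{S}$ its restriction to $\Omega\cap(\mathbb{R}^{p+1}\oplus\underline{\omega}\mathbb{R})$ is $C^1$ and satisfies $(D_{\mathbf{x}_p}+\underline{\omega}\partial_r)f(\mathbf{x}_p+r\underline{\omega})=0$. *)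

(* Defs.v *)
From HB Require Import structures.
From mathcomp Require Import all_boot all_order all_algebra.
From mathcomp Require Import all_classical all_reals all_analysis.
Set Implicit Arguments. Unset Strict Implicit. Unset Printing Implicit Defensive.
Import Order.TTheory GRing.Theory Num.Theory.
Import numFieldNormedType.Exports.
Local Open Scope ring_scope.

(* A real algebra of finite dimension d, realised on coordinates R^d
   (= 'rV[R]_d), with a bilinear multiplication, a unity, and an
   anti-involution.  Real numbers a are identified with a *: aone. *)
Record altalg (R : realType) (d : nat) := AltAlg {
  amul : 'rV[R]_d -> 'rV[R]_d -> 'rV[R]_d;
  aone : 'rV[R]_d;
  aconj : 'rV[R]_d -> 'rV[R]_d;
  amulDl : forall (a : R) x y z, amul (a *: x + y) z = a *: amul x z + amul y z;
  amulDr : forall (a : R) x y z, amul z (a *: x + y) = a *: amul z x + amul z y;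
  amul1l : forall x, amul aone x = x;
  amul1r : forall x, amul x aone = x;
  aassoc_xxy : forall x y, amul (amul x x) y - amul x (amul x y) = 0;
  aassoc_xyx : forall x y, amul (amul x y) x - amul x (amul y x) = 0;
  aassoc_yxx : forall x y, amul (amul y x) x - amul y (amul x x) = 0;
  aconjD : forall (a : R) x y, aconj (a *: x + y) = a *: aconj x + aconj y;
  aconj_real : forall a : R, aconj (a *: aone) = a *: aone;
  aconjK : forall x, aconj (aconj x) = x;
  aconjM : forall x y, aconj (amul x y) = amul (aconj y) (aconj x)
}.

Section AltAlgDefs.
Variables (R : realType) (d : nat) (A : altalg R d).

Definition is_real (x : 'rV[R]_d) := exists a : R, x = a *: aone A.
Definition atrace (x : 'rV[R]_d) := x + aconj A x.
Definition anorm (x : 'rV[R]_d) := amul A x (aconj A x).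

Definition sphereA (x : 'rV[R]_d) := atrace x = 0 /\ anorm x = aone A.

Definition quadcone (x : 'rV[R]_d) :=
  is_real x \/
  exists a b : R, atrace x = a *: aone A /\ anorm x = b *: aone A /\ a ^+ 2 < 4 * b.

Variables (p q : nat).
(* indices 0..m with m = p + q; index lshift q s is s (s <= p), index
   rshift p.+1 j is p+1+j *)
Definition idx := 'I_(p.+1 + q).

Definition elemM (v : idx -> 'rV[R]_d) (x : 'rV[R]_(p.+1 + q)) : 'rV[R]_d :=
  \sum_(s : idx) x ord0 s *: v s.

Definition admissible_basis (v : idx -> 'rV[R]_d) :=
  [/\ v (lshift q ord0) = aone A,
      forall s : idx, s != lshift q ord0 -> sphereA (v s),
      forall s t : idx, s != lshift q ord0 -> t != lshift q ord0 -> s != t ->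
        amul A (v s) (v t) = - amul A (v t) (v s),
      forall x : 'rV[R]_(p.+1 + q), elemM v x = 0 -> x = 0 &
      forall x : 'rV[R]_(p.+1 + q), quadcone (elemM v x)].

Definition pderiv (f : 'rV[R]_(p.+1) -> 'rV[R]_d) (s : 'I_p.+1) :=
  fun y : 'rV[R]_(p.+1) => 'D_(delta_mx 0 s) f y.

Definition lapl (f : 'rV[R]_(p.+1) -> 'rV[R]_d) :=
  fun y => \sum_(s < p.+1) pderiv (pderiv f s) s y.

Definition mlapl_pow (k : nat) (f : 'rV[R]_(p.+1) -> 'rV[R]_d) :=
  iter k (fun g => fun y => - lapl g y) f.

Definition diracp (v : idx -> 'rV[R]_d) (f : 'rV[R]_(p.+1) -> 'rV[R]_d) :=
  fun y => \sum_(s < p.+1) amul A (v (lshift q s)) (pderiv f s y).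

Definition omegaM (v : idx -> 'rV[R]_d) (w : 'rV[R]_q) : 'rV[R]_d :=
  \sum_(j < q) w ord0 j *: v (rshift p.+1 j).

Definition C1slice (g : 'rV[R]_(p.+1) * R -> 'rV[R]_d) :=
  continuous g /\
  (forall s : 'I_p.+1,
     (forall z, derivable g z (delta_mx 0 s, 0)) /\
     continuous (fun z => 'D_(delta_mx 0 s, 0) g z)) /\
  (forall z, derivable g z (0, 1)) /\
  continuous (fun z => 'D_((0 : 'rV[R]_(p.+1)), (1 : R)) g z).

(* left generalized partial-slice monogenic of type (p,q) on Omega = M,
   f given in the coordinates (x_0, ..., x_m) *)
Definition gpsm (v : idx -> 'rV[R]_d) (f : 'rV[R]_(p.+1 + q) -> 'rV[R]_d) :=
  forall w : 'rV[R]_q, \sum_(j < q) w ord0 j ^+ 2 = 1 ->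
    let g := fun z : 'rV[R]_(p.+1) * R => f (row_mx z.1 (z.2 *: w)) in
    C1slice g /\
    forall z, \sum_(s < p.+1) amul A (v (lshift q s)) ('D_(delta_mx 0 s, 0) g z)
              + amul A (omegaM v w) ('D_((0 : 'rV[R]_(p.+1)), (1 : R)) g z) = 0.

Definition polynomial_fun (f : 'rV[R]_(p.+1) -> 'rV[R]_d) :=
  exists (N : nat) (c : 'I_N -> 'rV[R]_d) (e : 'I_N -> 'I_p.+1 -> nat),
    forall y, f y = \sum_(i < N) (\prod_(s < p.+1) y ord0 s ^+ e i s) *: c i.

Definition CK (v : idx -> 'rV[R]_d) (f0 : 'rV[R]_(p.+1) -> 'rV[R]_d)
    (x : 'rV[R]_(p.+1 + q)) : 'rV[R]_d :=
  let xp := lsubmx x in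
  let xq := rsubmx x in
  let r := Num.sqrt (\sum_(j < q) xq ord0 j ^+ 2) in
  let om := omegaM v (r^-1 *: xq) in
  limn (series (fun k => (r ^+ (2 * k) / (2 * k)`!%:R) *: mlapl_pow k f0 xp))
  + amul A om
      (limn (series (fun k => (r ^+ (2 * k).+1 / (2 * k).+1`!%:R)
                              *: mlapl_pow k (diracp v f0) xp))).

End AltAlgDefs.

(* Main.v *)
(* On a slice, left multiplications turn the equation into a first-order system
   (sum_s V_s d_s + O d_r) f = 0 with O^2 = -1, that is d_r f = B f for
   B = O (sum_s V_s d_s).  The Clifford relations, which follow from alternativity,
   give B^2 = -Laplacian, so CK[f_0] is exp(r B) f_0, a finite sum.

   Uniqueness is proved for C^1 solutions without growth condition.  Averaging a
   solution over small segments in all directions makes its components harmonic,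
   and comparison with a quadratic barrier bounds central differences in r by
   C r t sup|f|; this passes to the limit and holds for C^1 solutions.  A solution
   vanishing on r = 0 stays a C^1 solution when extended by 0 to r <= 0.  Iterating
   the difference bound k times on cubes of size 1/k and summing the differences
   back from the region where everything vanishes gives |f| <= M (C r)^k for small
   r and all k, hence f = 0 on a slab of fixed width, and then everywhere. *)
Require Import Defs.
From HB Require Import structures.
From mathcomp Require Import all_boot all_order all_algebra.
From mathcomp Require Import all_classical all_reals all_analysis.
From mathcomp Require Import ring lra.
Import Order.TTheory GRing.Theory Num.Theory.
Import numFieldNormedType.Exports.
Local Open Scope ring_scope.

Set Implicit Arguments.
Unset Strict Implicit.
Unset Printing Implicit Defensive.
Local Open Scope classical_set_scope.

(** * Continuity and averages along segments *)

(** The algebra is not associative, so an element acts through the matrix of its left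
    multiplication. Linearising the alternative law gives x(ya) + y(xa) = (xy + yx)a, and this turns
    relations between basis elements into relations between matrices, where products may be
    regrouped freely.

    A solution has only first derivatives, so its Laplacian has no meaning at the outset. An average
    in direction i turns d_i into a difference quotient, an operation under which C^1 solutions are
    stable; each direction thus gains one derivative.

    The constants of the uniqueness argument balance as follows, for n+1 variables. With time step
    r/k and cubes of size 1/k, a k-th difference is at most ((n+1)k)^k M. Summing back takes 2k
    steps from time -r to time r and costs 4^k (r/k)^k. The powers of k cancel and leave M
    (4(n+1)r)^k, so r <= 1/(8(n+1)) gives M 2^-k. This width does not depend on the solution, hence
    translation in r repeats the argument. *)

Section continuous_functions.
Context {R : realType} {T : topologicalType}.
Implicit Types f g : T -> R.

Lemma contD f g : continuous f -> continuous g -> continuous (fun z => f z + g z).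
Proof. by move=> cf cg z; apply: cvgD; [exact: cf|exact: cg]. Qed.

Lemma contB f g : continuous f -> continuous g -> continuous (fun z => f z - g z).
Proof. by move=> cf cg z; apply: cvgB; [exact: cf|exact: cg]. Qed.

Lemma contM f g : continuous f -> continuous g -> continuous (fun z => f z * g z).
Proof. by move=> cf cg z; apply: cvgM; [exact: cf|exact: cg]. Qed.

Lemma cont_cst (k : R) : continuous (fun _ : T => k).
Proof. by move=> z; exact: cvg_cst. Qed.

Lemma cont_norm f : continuous f -> continuous (fun z => `|f z|).
Proof. by move=> cf z; apply: cvg_norm; exact: cf. Qed.

Lemma cont_sum (I : Type) (l : seq I) (F : I -> T -> R) :
  (forall i, continuous (F i)) -> continuous (fun z => \sum_(i <- l) F i z).
Proof.
move=> cF; elim: l => [|i l IH].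
  by under eq_fun do rewrite big_nil; exact: cont_cst.
by under eq_fun do rewrite big_cons; apply: contD.
Qed.

Lemma cont_id : continuous (@id T).
Proof. by move=> z; exact: cvg_id. Qed.

Lemma contDv (V : normedModType R) (f g : T -> V) :
  continuous f -> continuous g -> continuous (fun z => f z + g z).
Proof. by move=> cf cg z; apply: cvgD; [exact: cf|exact: cg]. Qed.

Lemma contNv (V : normedModType R) (f : T -> V) :
  continuous f -> continuous (fun z => - f z).
Proof. by move=> cf z; apply: cvgN; exact: cf. Qed.

Lemma contZv (V : normedModType R) (f : T -> R) (v : V) :
  continuous f -> continuous (fun z => f z *: v).
Proof. by move=> cf z; apply: cvgZr_tmp; exact: cf. Qed.

Lemma contZZ (V : normedModType R) (f : T -> R) (g : T -> V) :
  continuous f -> continuous g -> continuous (fun z => f z *: g z).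
Proof. by move=> cf cg z; apply: cvgZ; [exact: cf|exact: cg]. Qed.

Lemma cont_sumv (V : normedModType R) (I : Type) (l : seq I) (F : I -> T -> V) :
  (forall i, continuous (F i)) -> continuous (fun z => \sum_(i <- l) F i z).
Proof.
move=> cF; elim: l => [|i l IH].
  by under eq_fun do rewrite big_nil; move=> z; exact: cvg_cst.
by under eq_fun do rewrite big_cons; apply: contDv.
Qed.

Lemma cont_cstv (V : normedModType R) (v : V) : continuous (fun _ : T => v).
Proof. by move=> z; exact: cvg_cst. Qed.

End continuous_functions.

Section directional_derivatives.
Context {R : realType} {V W U : normedModType R}.

Lemma is_derive_opp_dir (f : V -> W) (z v : V) (df : W) :
  is_derive z v f df -> is_derive z (- v) f (- df).
Proof.
move=> [d0 <-]; rewrite /derivable in d0.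
have L : (fun h : R => h^-1 *: ((f \o shift z) (h *: - v) - f z)) @ 0^' --> - 'D_v f z.
  have -> : (fun h : R => h^-1 *: ((f \o shift z) (h *: - v) - f z)) =
     (fun h => - ((- h)^-1 *: ((f \o shift z) ((- h) *: v) - f z))).
    by apply/funext => h; rewrite invrN scaleNr opprK scalerN scaleNr.
  apply: cvgN; apply: (@cvg_comp _ _ _ (fun h : R => - h) (fun h => h^-1 *: ((f \o shift z) (h *: v) - f z)) _ (0 : R)^'); last exact: d0.
  move=> A [eps eps0 H]; exists eps => // h; rewrite /ball_/= sub0r normrN => hd h0.
  by apply: H; rewrite /ball_/= ?sub0r ?opprK ?oppr_eq0.
split; first by apply/cvg_ex; exists (- 'D_v f z).
exact: cvg_lim L.
Qed.

Lemma is_derive_bigsum (I : Type) (l : seq I)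
    (f : I -> V -> W) (df : I -> W) (z v : V) :
  (forall k, is_derive z v (f k) (df k)) ->
  is_derive z v (fun y => \sum_(k <- l) f k y) (\sum_(k <- l) df k).
Proof.
move=> H; elim: l => [|k l IH].
  by rewrite big_nil; under eq_fun do rewrite big_nil; exact: is_derive_cst.
by rewrite big_cons; under eq_fun do rewrite big_cons; exact: is_deriveD.
Qed.

(** Both difference quotients are literally the same function of h. This chain rule works with
    directional derivability alone, the only kind of differentiability that [C1] and [C1slice]
    provide. *)
Lemma is_derive_comp_affine (phi : U -> V) (f : V -> W) (z v : U) (v' : V) df :
  (forall h : R, phi (h *: v + z) = h *: v' + phi z) ->
  is_derive (phi z) v' f df -> is_derive z v (f \o phi) df.
Proof.
move=> H [d0 <-]; rewrite /derivable in d0.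
have E1 : (fun h : R => h^-1 *: (((f \o phi) \o shift z) (h *: v) - (f \o phi) z)) =
   (fun h => h^-1 *: ((f \o shift (phi z)) (h *: v') - f (phi z))).
  by apply/funext => h /=; rewrite H.
by split; [rewrite /derivable E1; exact: d0|rewrite /derive E1].
Qed.

End directional_derivatives.

Section derivatives_along_lines.
Context {R : realType} {V W : normedModType R}.

Lemma is_derive_line (f : V -> W) (v z : V) (s : R) : derivable f (s *: v + z) v ->
  is_derive s 1 (fun h : R => f (h *: v + z)) ('D_v f (s *: v + z)).
Proof.
move=> df; apply: (is_derive_comp_affine (phi := fun h : R => h *: v + z) (v' := v)).
  by move=> h; rewrite scalerDl addrA [h *: 1]mulr1.
exact: derivableP.
Qed.

Lemma is_derive_translation (f : V -> W) (w v z : V) : derivable f (w + z) v ->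
  is_derive z v (fun y => f (w + y)) ('D_v f (w + z)).
Proof.
move=> df; apply: (is_derive_comp_affine (phi := fun y => w + y) (v' := v)).
  by move=> h; rewrite addrCA.
exact: derivableP.
Qed.

End derivatives_along_lines.

Section coordinates.
Context {R : realType} {n : nat}.
Local Notation E := 'rV[R]_n.

Lemma is_derive_coord (z v : E) i : is_derive z v (fun y : E => y 0 i) (v 0 i).
Proof.
have L : (fun h : R => h^-1 *: (((fun y : E => y 0 i) \o shift z) (h *: v) - z 0 i)) @ 0^' --> v 0 i.
  apply: (cvg_trans (G := (fun=> v 0 i) @ (0 : R)^')); last exact: cvg_cst.
  apply: near_eq_cvg; near=> h.
  have h0 : h != 0 by near: h; exact: nbhs_dnbhs_neq.
  by rewrite /= !mxE addrK [_ *: _]mulrA mulVf// mul1r.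
split; first by apply/cvg_ex; exists (v 0 i).
exact: cvg_lim L.
Unshelve. all: by end_near. Qed.

End coordinates.

Section averages.
Context {R : realType} {n : nat}.
Local Notation E := 'rV[R]_n.+1.
Local Notation e i := (delta_mx 0 i : E).
Local Notation mu := (@lebesgue_measure R).
Implicit Types (f g : E -> R) (i j : 'I_n.+1) (z : E).

Definition C1 f := continuous f /\
  forall i, (forall z, derivable f z (e i)) /\ continuous ('D_(e i) f).

Lemma continuous_line (T : topologicalType) (f : E -> T) (v z : E) :
  continuous f -> continuous (fun s : R => f (s *: v + z)).
Proof.
move=> cf s; apply: (@continuous_comp _ _ _ (fun s : R => s *: v + z)); last exact: cf.
apply: (@cvgD R); [apply: cvgZr_tmp; exact: cvg_id | exact: cvg_cst].
Qed.

Lemma continuous_translation (T : topologicalType) (f : E -> T) (v : E) :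
  continuous f -> continuous (fun z => f (v + z)).
Proof.
move=> cf s; apply: (@continuous_comp _ _ _ (fun z => v + z)); last exact: cf.
exact: (cvgD (cvg_cst _) cvg_id).
Qed.

(** Compactness of [0, r] makes continuity uniform along the segment, as in the tube lemma. It
    yields continuity of averages and the domination needed to differentiate them. *)
Lemma near_segment f (v z : E) (r eta : R) : continuous f -> 0 < eta ->
  \forall z' \near z, forall s, s \in `[0, r]%R ->
    `|f (s *: v + z') - f (s *: v + z)| < eta.
Proof.
move=> cf eta0.
have := @segment_compact R 0 r => /compact_near_coveringP.
move=> /(_ _ (nbhs z) (fun z' s => `|f (s *: v + z') - f (s *: v + z)| < eta) _).
move=> H; apply: filterS (H _) => [z' Hz' s sI|].
  exact: Hz'.
move=> s sI.
have c1 : {for (s, z), continuous (fun p : R * E => p.1 *: v + p.2)}.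
  apply: cvgD; last exact: cvg_snd.
  by apply: cvgZr_tmp; exact: cvg_fst.
have c2 : (fun p : R * E => f (p.1 *: v + p.2) - f (p.1 *: v + z))
    @ (s, z) --> (f (s *: v + z) - f (s *: v + z)).
  apply: cvgB.
    by apply: (@continuous_comp _ _ _ (fun p : R * E => p.1 *: v + p.2)); [exact: c1|exact: cf].
  apply: (@continuous_comp _ _ _ (fun p : R * E => p.1) (fun t : R => f (t *: v + z)) (s, z)).
    exact: cvg_fst.
  exact: continuous_line.
rewrite subrr in c2.
exact: (cvgr0_norm_lt _ c2 _ eta0).
Qed.

Lemma integrable_segment (f : R -> R) (r : R) : continuous f ->
  mu.-integrable `[0, r] (EFin \o f).
Proof.
move=> cf; apply: continuous_compact_integrable; first exact: segment_compact.
exact: continuous_subspaceT.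
Qed.

(** Steklov average over the segment from z to z + r e_i. It is one-sided so that averaging d_i f
    produces a forward difference quotient. *)
Definition avg (r : R) i f z :=
  r^-1 * \int[mu]_(s in `[0, r]) f (s *: e i + z).

Section fixed_radius.
Variables (r : R) (r0 : 0 < r).

Lemma avg_near i f z (c eta : R) : continuous f ->
  (forall s, s \in `[0, r]%R -> `|f (s *: e i + z) - c| <= eta) ->
  `|avg r i f z - c| <= eta.
Proof.
move=> cf H.
have fi := @integrable_segment _ r (@continuous_line _ f (e i) z cf).
have ci k : mu.-integrable `[0, r] (EFin \o cst k).
  by apply: integrable_segment; exact: cst_continuous.
have muE : fine (mu `[0, r]) = r.
  by rewrite lebesgue_measure_itv/= lte_fin r0 -EFinD/= subr0.
have cE k : \int[mu]_(s in `[0, r]) k = k * r.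
  by rewrite Rintegral_cst// muE.
rewrite -(@ler_pM2l _ r)// -{1}(gtr0_norm r0) -normrM mulrBr /avg mulVKf ?gt_eqF//.
rewrite -[r * c]mulrC -[c * r]cE -RintegralB//; last exact: ci.
apply: (le_trans (le_normr_Rintegral _ _)) => //.
  apply: (@integrable_segment (fun s => f (s *: e i + z) - c)).
  by apply: contB; [exact: continuous_line|exact: cont_cst].
rewrite mulrC -cE; apply: le_Rintegral => //.
- apply: (@integrable_segment (fun s => `|f (s *: e i + z) - c|)).
  by apply/cont_norm/contB; [exact: continuous_line|exact: cont_cst].
- exact: ci.
Qed.

Lemma avgD i f g z : continuous f -> continuous g ->
  avg r i (f \+ g) z = avg r i f z + avg r i g z.
Proof.
move=> cf cg; rewrite /avg -mulrDr RintegralD//.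
- by apply: integrable_segment; exact: continuous_line.
- by apply: integrable_segment; exact: continuous_line.
Qed.

Lemma avgZ i f z (k : R) : continuous f ->
  avg r i (fun z => k * f z) z = k * avg r i f z.
Proof.
move=> cf; rewrite /avg RintegralZl//; first by ring.
by apply: integrable_segment; exact: continuous_line.
Qed.

Lemma avgB i f g z : continuous f -> continuous g ->
  avg r i (fun z => f z - g z) z = avg r i f z - avg r i g z.
Proof.
move=> cf cg; rewrite /avg -mulrBr RintegralB//.
- by apply: integrable_segment; exact: continuous_line.
- by apply: integrable_segment; exact: continuous_line.
Qed.

Lemma continuous_avg i f : continuous f -> continuous (avg r i f).
Proof.
move=> cf z; apply/(@cvgrPdist_le _ _ _ (nbhs z)) => eta eta0.
have N := near_segment (e i) z r cf eta0. apply: (@filterS _ (nbhs z) _ _ _ _ N) => z' H.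
rewrite distrC.
have -> : avg r i f z' - avg r i f z =
    avg r i (fun y => f ((z' - z) + y) - f y) z - 0.
  rewrite avgB//; last exact: continuous_translation.
  rewrite subr0 /avg; congr (_ * _ - _).
  by apply: eq_Rintegral => s _; congr f; rewrite addrCA subrK.
apply: avg_near.
  by apply: contB => //; exact: continuous_translation.
move=> s sI; rewrite subr0; apply: ltW.
by rewrite [_ - _ + _]addrCA subrK; exact: H.
Qed.

Lemma is_derive_avg i j f z : C1 f ->
  is_derive z (e j) (avg r i f) (avg r i ('D_(e j) f) z).
Proof.
move=> [cf Df]; have [df cdf] := Df j.
have dline (x : R) (y : E) := is_derive_line (df (x *: e j + y)).
have [M HM] : exists M, forall s, s \in `[0, r]%R -> `|'D_(e j) f (s *: e i + z)| <= M.
  have c2 : continuous (fun s : R => `|'D_(e j) f (s *: e i + z)|).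
    exact: (cont_norm (@continuous_line _ ('D_(e j) f) (e i) z cdf)).
  have [c _ Hc] := EVT_max (ltW r0) (continuous_subspaceT c2).
  by exists `|'D_(e j) f (c *: e i + z)|.
have : \forall h \near (0 : R), forall s, s \in `[0, r]%R ->
    `|'D_(e j) f (s *: e i + (h *: e j + z)) - 'D_(e j) f (s *: e i + z)| < 1.
  have := near_segment (e i) z r cdf ltr01.
  have : (fun h : R => h *: e j + z) @ 0 --> z.
    have := @continuous_line E id (e j) z (fun _ => cvg_id) 0.
    by rewrite /continuous_at scale0r add0r.
  move=> cc /cc; apply: (@filterS _ (nbhs (0 : R))) => h H s sI.
  exact: (H s sI).
move=> /nbhs_ballP[d /= d0 Hd].
pose F (h s : R) := f (s *: e i + (h *: e j + z)).
have FE (h s : R) : F h s = f (h *: e j + (s *: e i + z)).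
  by rewrite /F; congr f; rewrite addrCA.
have dF (h s : R) : is_derive h 1 (F ^~ s) ('D_(e j) f (s *: e i + (h *: e j + z))).
  rewrite addrCA; have := dline h (s *: e i + z).
  by rewrite (_ : (fun h0 : R => f (h0 *: e j + (s *: e i + z))) = F ^~ s)//; apply/funext => h'; rewrite FE.
have pF (h s : R) : partial1of2 F h s = 'D_(e j) f (s *: e i + (h *: e j + z)).
  by rewrite partial1of2E; have := dF h s => -[].
(* The constant M + 1 dominates: M bounds the derivative on the segment through z, and a
   displacement smaller than d along e_j changes it by less than 1. *)
have := @cvg_differentiation_under_integral R _ _ mu F `[0, r] _ 0 (- d) d _ _ _ (cst (M + 1)).
move=> /(_ _ _ _ _ _ _ _) H.
have {}H : h^-1 *: (\int[mu]_(y in `[0, r]) F (h + 0) y - \int[mu]_(y in `[0, r]) F 0 y) @[h --> 0^']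
    --> \int[mu]_(y in `[0, r]) partial1of2 F 0 y.
  apply: H => //=.
  - by rewrite in_itv/= oppr_lt0 d0.
  - move=> h _; apply: integrable_segment.
    exact: continuous_line.
  - move=> _; have M0 : 0 <= M.
      by apply: le_trans (HM 0 _); rewrite ?normr_ge0// in_itv/= lexx ltW.
    by rewrite /cst addr_ge0.
  - by apply: integrable_segment; exact: cst_continuous.
  - move=> h s hI sI; rewrite pF.
    have hb : ball (0 : R) d h.
      by rewrite /ball/= sub0r normrN ltr_norml; move: hI; rewrite in_itv.
    have H1 := Hd h hb s sI.
    rewrite -[X in `|X|](subrK ('D_(e j) f (s *: e i + z))) addrC.
    by apply: (le_trans (ler_normD _ _)); rewrite lerD ?HM// ltW.
have avgE (h : R) : avg r i f (h *: e j + z) = r^-1 * \int[mu]_(y in `[0, r]) F (h + 0) y.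
  by rewrite /avg addr0.
have avg0 : avg r i f z = r^-1 * \int[mu]_(y in `[0, r]) F 0 y.
  by rewrite -[X in r^-1 * \int[mu]_(y in `[0, r]) F X y]addr0 -avgE scale0r add0r.
have DE : (fun h : R => h^-1 *: ((avg r i f \o shift z) (h *: e j) - avg r i f z)) =
   (fun h => r^-1 * (h^-1 *: (\int[mu]_(y in `[0, r]) F (h + 0) y - \int[mu]_(y in `[0, r]) F 0 y))).
  apply/funext => h; rewrite /shift [(_ \o _) _]/= avgE avg0.
  move: (\int[mu]_(y in _) F (h + 0) y) (\int[mu]_(y in _) F 0 y) => X Y.
  by rewrite -mulrBr [LHS]mulrCA.
have L : (fun h : R => h^-1 *: ((avg r i f \o shift z) (h *: e j) - avg r i f z)) @ 0^' --> avg r i ('D_(e j) f) z.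
  rewrite DE; have -> : avg r i ('D_(e j) f) z = r^-1 * \int[mu]_(y in `[0, r]) partial1of2 F 0 y.
    have IE : \int[mu]_(s in `[0, r]) 'D_(e j) f (s *: e i + z) =
        \int[mu]_(y in `[0, r]) partial1of2 F 0 y.
      by apply: eq_Rintegral => s _; rewrite pF scale0r add0r.
    by rewrite /avg IE.
  exact: cvgMl_tmp.
split; first by apply/cvg_ex; exists (avg r i ('D_(e j) f) z).
exact: cvg_lim L.
Qed.

Lemma C1_avg i f : C1 f -> C1 (avg r i f).
Proof.
move=> fC; have [cf Df] := fC; split; first exact: continuous_avg.
move=> j; have [_ cdf] := Df j; split.
  by move=> z; have [] := is_derive_avg i j z fC.
rewrite (_ : 'D_(e j) (avg r i f) = avg r i ('D_(e j) f)); first exact: continuous_avg.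
by apply/funext => z; have [] := is_derive_avg i j z fC.
Qed.

End fixed_radius.
End averages.

(** * Iterated averages and difference quotients *)

Section iterated_averages.
Context {R : realType} {n : nat}.
Local Notation E := 'rV[R]_n.+1.
Local Notation e i := (delta_mx 0 i : E).
Implicit Types (f g : E -> R) (i j : 'I_n.+1) (z : E) (l : seq 'I_n.+1).

Definition dq (r : R) i f z := r^-1 * (f (r *: e i + z) - f z).

Lemma continuous_dq r i f : continuous f -> continuous (dq r i f).
Proof.
move=> cf; apply: contM; first exact: cont_cst.
by apply: contB => //; exact: continuous_translation.
Qed.

Lemma is_derive_dq r i j f z : C1 f ->
  is_derive z (e j) (dq r i f) (dq r i ('D_(e j) f) z).
Proof.
move=> [_ /(_ j)[df _]].
have d1 := is_derive_translation (df (r *: e i + z)).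
have d2 := derivableP (df z).
have D := is_deriveB d1 d2; have := is_deriveZ r^-1 D; exact.
Qed.

Lemma derive_dq r i j f : C1 f -> 'D_(e j) (dq r i f) = dq r i ('D_(e j) f).
Proof. by move=> fC; apply/funext => z; have [] := is_derive_dq r i j z fC. Qed.

Lemma derive_dqE r i j f z : C1 f -> 'D_(e j) (dq r i f) z = dq r i ('D_(e j) f) z.
Proof. by move=> fC; have [] := is_derive_dq r i j z fC. Qed.

Lemma C1_dq r i f : C1 f -> C1 (dq r i f).
Proof.
move=> fC; have [cf Df] := fC; split; first exact: continuous_dq.
move=> j; split; first by move=> z; have [] := is_derive_dq r i j z fC.
by rewrite derive_dq//; apply: continuous_dq; have [] := Df j.
Qed.

Lemma dqC r i j f : dq r i (dq r j f) = dq r j (dq r i f).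
Proof. by apply/funext => z; rewrite /dq (addrCA (r *: e j)); ring. Qed.

Section fixed_radius.
Variables (r : R) (r0 : 0 < r).

Lemma derive_avg i j f : C1 f -> 'D_(e j) (avg r i f) = avg r i ('D_(e j) f).
Proof. by move=> fC; apply/funext => z; have [] := is_derive_avg r0 i j z fC. Qed.

(** Fundamental theorem of calculus on the segment. The right-hand side contains no derivative and
    can be differentiated again, which is the gain in regularity. *)
Lemma avg_derive i f : C1 f -> avg r i ('D_(e i) f) = dq r i f.
Proof.
move=> [cf /(_ i)[df cdf]]; apply/funext => z; rewrite /avg /dq /Rintegral; congr (_ * _).
have dF (s : R) := is_derive_line (df (s *: e i + z)).
rewrite (@continuous_FTC2 _ _ (fun s : R => f (s *: e i + z)))//=.
- by rewrite scale0r add0r.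
- by apply: continuous_subspaceT; exact: (@continuous_line _ _ _ ('D_(e i) f) (e i) z cdf).
- split.
  + by move=> s _; have [] := dF s.
  + by apply: cvg_at_right_filter; exact: (@continuous_line _ _ _ f (e i) z cf 0).
  + by apply: cvg_at_left_filter; exact: (@continuous_line _ _ _ f (e i) z cf r).
- by move=> s _; rewrite derive1E; have [_] := dF s.
Qed.

Lemma avg_dq i j f : continuous f -> avg r i (dq r j f) = dq r j (avg r i f).
Proof.
move=> cf; apply/funext => z.
have ct := @continuous_translation _ _ _ f (r *: e j) cf.
transitivity (r^-1 * avg r i (fun y => f (r *: e j + y) - f y) z).
  exact: (avgZ r i z r^-1 (contB ct cf)).
transitivity (r^-1 * (avg r i (fun y => f (r *: e j + y)) z - avg r i f z)).
  by apply: congr1; exact: avgB.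
have E3 : avg r i (fun y => f (r *: e j + y)) z = avg r i f (r *: e j + z).
  rewrite /avg; congr (_ * _).
  by apply: eq_Rintegral => s _; rewrite addrCA.
by rewrite E3.
Qed.

#[local] Opaque avg.

Definition avgs l f := foldr (avg r) f l.

Lemma continuous_avgs l f : continuous f -> continuous (avgs l f).
Proof. by move=> cf; elim: l => //= i l IH; exact: continuous_avg. Qed.

Lemma C1_avgs l f : C1 f -> C1 (avgs l f).
Proof. by move=> cf; elim: l => //= i l IH; exact: C1_avg. Qed.

Lemma derive_avgs l j f : C1 f -> 'D_(e j) (avgs l f) = avgs l ('D_(e j) f).
Proof.
by move=> fC; elim: l => //= i l IH; rewrite derive_avg ?IH//; exact: C1_avgs.
Qed.

Lemma derive_avgsE l j f z : C1 f -> 'D_(e j) (avgs l f) z = avgs l ('D_(e j) f) z.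
Proof. by move=> fC; rewrite -derive_avgs. Qed.

Lemma avgs_dq l j f : continuous f -> avgs l (dq r j f) = dq r j (avgs l f).
Proof.
by move=> fC; elim: l => //= i l IH; rewrite IH avg_dq//; exact: continuous_avgs.
Qed.

(** The derivative passes through the averages until it meets the one in direction j and cancels it;
    the difference quotient left behind commutes with the averages outside. *)
Lemma avgs_derive l j f : C1 f -> j \in l ->
  avgs l ('D_(e j) f) = avgs (rem j l) (dq r j f).
Proof.
move=> fC; elim: l => //= i l IH; rewrite inE eq_sym.
have [-> _|ij /= jl] := eqVneq i j; last by rewrite IH.
rewrite -derive_avgs// avg_derive; last exact: C1_avgs.
by rewrite avgs_dq//; case: fC.
Qed.

Lemma derive_avgs_rem l j f : C1 f -> j \in l ->
  'D_(e j) (avgs l f) = avgs (rem j l) (dq r j f).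
Proof. by move=> fC jl; rewrite derive_avgs// avgs_derive. Qed.

Lemma avgs_lin l (I : Type) (s : seq I) (c : I -> R) (F : I -> E -> R) z :
  (forall k, continuous (F k)) ->
  avgs l (fun z => \sum_(k <- s) c k * F k z) z = \sum_(k <- s) c k * avgs l (F k) z.
Proof.
move=> cF; elim: l z => //= j0 l IH z.
have -> : avgs l (fun z => \sum_(k <- s) c k * F k z) =
    (fun z => \sum_(k <- s) c k * avgs l (F k) z) by exact/funext.
elim: s {IH} => [|k0 s IHs].
  rewrite big_nil; under eq_fun do rewrite big_nil.
  have := @avgZ _ _ r j0 (cst 0) z 0 (@cont_cst _ _ 0).
  by rewrite mul0r; under eq_fun do rewrite mul0r.
rewrite big_cons; under eq_fun do rewrite big_cons.
have ca k : continuous (fun z => c k * avgs l (F k) z).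
  by apply: contM; [exact: cont_cst|exact: continuous_avgs].
by rewrite avgD ?IHs ?avgZ//; [exact: continuous_avgs|apply: cont_sum].
Qed.

(** Every average moves one coordinate by at most r, so the whole family moves each coordinate by at
    most [size l] times r. With c = 0 this is a bound, with c = f z an approximation. *)
Lemma avgs_near l f z (c eta : R) : continuous f ->
  (forall z', (forall k, `|z' 0 k - z 0 k| <= (size l)%:R * r) ->
    `|f z' - c| <= eta) ->
  `|avgs l f z - c| <= eta.
Proof.
move=> cf; elim: l z => [|i l IH] z H /=.
  by apply: H => k; rewrite subrr normr0 mul0r.
apply: avg_near => //; first exact: continuous_avgs.
move=> s; rewrite in_itv/= => /andP[s0 sr]; apply: IH => z' Hz'; apply: H => k.
rewrite -(subrK ((s *: e i + z) 0 k) (z' 0 k)) -addrA.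
apply: (le_trans (ler_normD _ _)); rewrite -natr1 mulrDl lerD// mul1r.
rewrite !mxE/= addrK; case: (k == i); rewrite ?mulr1 ?mulr0 ?normr0 ?ger0_norm//.
exact: ltW.
Qed.

End fixed_radius.
End iterated_averages.

(** * First-order systems factoring the Laplacian *)

Section first_order_system.
Context {R : realType} {n d : nat}.
Local Notation E := 'rV[R]_n.+1.
Local Notation e i := (delta_mx 0 i : E).
Implicit Types (T : 'I_n.+1 -> 'M[R]_d) (h : 'I_d -> E -> R).

Definition C1sol T h := (forall b, C1 (h b)) /\
  forall z, \sum_s (\row_b 'D_(e s) (h b) z) *m T s = 0.

(** Each component of the system becomes a single scalar combination of partial derivatives indexed
    by pairs, the shape to which [avgs_lin] applies. *)
Lemma C1sol_eq T h a z :
  (\sum_s (\row_b 'D_(e s) (h b) z) *m T s) 0 a =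
  \sum_(k : 'I_n.+1 * 'I_d) T k.1 k.2 a * 'D_(e k.1) (h k.2) z.
Proof.
rewrite summxE -(pair_bigA _ (fun s b => T s b a * 'D_(e s) (h b) z))/=.
by apply: eq_bigr => s _; rewrite mxE; apply: eq_bigr => b _; rewrite mxE mulrC.
Qed.

Lemma C1sol_dq T h r j : C1sol T h -> C1sol T (fun b => dq r j (h b)).
Proof.
move=> [hC hT]; split; first by move=> b; exact: C1_dq.
move=> z; apply/rowP => a; rewrite C1sol_eq mxE.
have := hT (r *: e j + z) => /rowP/(_ a); rewrite C1sol_eq mxE => H1.
have := hT z => /rowP/(_ a); rewrite C1sol_eq mxE => H2.
under eq_bigr do rewrite derive_dqE// /dq mulrCA mulrBr.
by rewrite -mulr_sumr sumrB H1 H2 subrr mulr0.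
Qed.

Lemma C1sol_avgs T h r l : 0 < r -> C1sol T h -> C1sol T (fun b => avgs r l (h b)).
Proof.
move=> r0 [hC hT]; split; first by move=> b; exact: C1_avgs.
move=> z; apply/rowP => a; rewrite C1sol_eq mxE.
under eq_bigr do rewrite derive_avgsE//.
rewrite -(avgs_lin r0 _ _ (fun k => T k.1 k.2 a)); last first.
  by move=> k; have [_ /(_ k.1)[]] := hC k.2.
(* The zero function is written as an empty combination, so that linearity also shows that its
   average is zero. *)
transitivity (avgs r l (fun z => \sum_(k <- [::] : seq nat) 0 * (fun=> 0) z) z).
  congr (avgs r l _ z).
  by apply/funext => y; rewrite big_nil -C1sol_eq hT mxE.
rewrite (avgs_lin r0 _ _ (fun=> 0) (F := fun=> (fun=> 0))) ?big_nil ?mxE//.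
by move=> _; exact: cont_cst.
Qed.

(** Polarised form of (sum_s x_s T_s)(sum_s x_s T'_s) = |x|^2: T' is a conjugate system whose
    composition with T is the Laplacian. *)
Definition clifford T (T' : 'I_n.+1 -> 'M[R]_d) :=
  forall s t, T t *m T' s + T s *m T' t = (2 *+ (s == t))%:M.

Lemma C1sol_derive_avgs T h r l j : 0 < r -> C1sol T h -> j \in l ->
  C1sol T (fun b => 'D_(e j) (avgs r l (h b))).
Proof.
move=> r0 hS jl; have [hC hT] := hS.
rewrite (_ : (fun b => _) = (fun b => avgs r (rem j l) (dq r j (h b)))).
  exact/C1sol_avgs/C1sol_dq.
by apply/funext => b; exact: derive_avgs_rem.
Qed.

(** For distinct i and j both sides use up the averages in directions i and j and become the same
    average of a double difference quotient, and difference quotients commute. *)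
Lemma derive_avgsC f r l i j z : 0 < r -> C1 f -> uniq l -> i \in l -> j \in l ->
  'D_(e i) ('D_(e j) (avgs r l f)) z = 'D_(e j) ('D_(e i) (avgs r l f)) z.
Proof.
move=> r0 fC lu il jl; have [->//|ij] := eqVneq i j.
suff H : 'D_(e i) ('D_(e j) (avgs r l f)) = 'D_(e j) ('D_(e i) (avgs r l f)) :> (E -> R).
  exact: (congr1 (fun g : E -> R => g z) H).
have fdq k : C1 (dq r k f) by exact: C1_dq.
rewrite (derive_avgs_rem r0 fC il) (derive_avgs_rem r0 fC jl).
rewrite (derive_avgs_rem r0 (fdq j)); last by rewrite mem_rem_uniq// inE ij.
rewrite (derive_avgs_rem r0 (fdq i)); last by rewrite mem_rem_uniq// inE eq_sym ij.
have -> : rem i (rem j l) = rem j (rem i l).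
  rewrite !rem_filter ?filter_uniq// -!filter_predI.
  by apply: eq_filter => k /=; rewrite andbC.
by rewrite dqC.
Qed.

(* Averaging once in every direction makes mixed second derivatives exist and
   commute, so that [T'] factors the Laplacian through the first-order system. *)
Lemma C1sol_harmonic T T' h r l z b : clifford T T' -> 0 < r -> C1sol T h ->
  uniq l -> (forall i, i \in l) ->
  \sum_i 'D_(e i) ('D_(e i) (avgs r l (h b))) z = 0.
Proof.
move=> TT r0 hS lu lA.
pose W i j : 'rV[R]_d := \row_b 'D_(e i) ('D_(e j) (avgs r l (h b))) z.
have WC i j : W i j = W j i.
  apply: eq_mx => _ c /=; have [hC _] := hS.
  exact: (derive_avgsC z r0 (hC c) lu (lA i) (lA j)).
have eq0 j : \sum_i W i j *m T i = 0.
  have [_ /(_ z) H] := C1sol_derive_avgs r0 hS (lA j); rewrite /W; exact: H.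
have S0 : \sum_j \sum_i W i j *m (T i *m T' j) = 0.
  rewrite big1// => j _; under eq_bigr do rewrite mulmxA.
  by rewrite -mulmx_suml eq0 mul0mx.
(* The sum is doubled and the indices are exchanged in one copy; as W is symmetric, the Clifford
   relation then leaves only twice the diagonal. *)
have : \sum_j \sum_i W i j *m (T i *m T' j) + \sum_j \sum_i W i j *m (T i *m T' j) = 0.
  by rewrite S0 addr0.
rewrite {2}exchange_big -big_split/=.
under eq_bigr => j _.
  rewrite -big_split/=.
  under eq_bigr => i _ do rewrite (WC j i) -mulmxDr TT.
  rewrite (bigD1 j)//= big1 ?addr0; last first.
    by move=> i /negPf ij; rewrite eq_sym ij mulr0n mul_mx_scalar scale0r.
  rewrite eqxx mulr1n mul_mx_scalar.
  over.
rewrite -scaler_sumr => /eqP; rewrite scaler_eq0 pnatr_eq0/= => /eqP H.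
transitivity ((\sum_i W i i) 0 b); last by rewrite H [LHS]mxE.
rewrite summxE; apply: eq_bigr => i _.
by rewrite [RHS]mxE.
Qed.

End first_order_system.

(** * Harmonic functions *)

Section maximum_principle.
Context {R : realType}.

(** If c > 0, then g, which vanishes at 0, is positive just to the right of 0, and by the mean value
    theorem f exceeds f 0 there. *)
Lemma second_derivative_at_max (f g : R -> R) (c del : R) : 0 < del ->
  (forall x : R, is_derive x 1 f (g x)) -> is_derive (0 : R) 1 g c ->
  (forall x, `|x| < del -> f x <= f 0) -> c <= 0.
Proof.
move=> del0 df dg fmax; rewrite leNgt; apply/negP => c0.
have g0 : g 0 = 0.
  have H : is_derive (0 : R) 1 f 0.
    apply: (@derive1_at_max _ f (- del) del).
    - by rewrite ge0_cp// ltW.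
    - by move=> x _; have [] := df x.
    - by rewrite in_itv/= oppr_lt0 del0.
    - by move=> x; rewrite in_itv/= => xd; apply: fmax; rewrite ltr_norml.
  by have [_ <-] := df 0; have [] := H.
have [dg0 dgE] := dg; rewrite /derivable in dg0.
have L : (fun h : R => h^-1 *: ((g \o shift 0) (h *: 1) - g 0)) @ 0^' --> c.
  by rewrite -dgE; exact: dg0.
have /nbhs_ballP[eps /= eps0 H] : \forall h \near 0^', 0 < h^-1 *: ((g \o shift 0) (h *: 1) - g 0).
  by apply: (cvgr_gt c L).
pose m := Num.min eps del / 2.
have m0 : 0 < m by rewrite divr_gt0// lt_min eps0 del0.
have me : m < eps.
  have : Num.min eps del <= eps by rewrite ge_min lexx.
  by move: m0; rewrite /m; lra.
have md : m < del.
  have : Num.min eps del <= del by rewrite ge_min lexx orbT.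
  by move: m0; rewrite /m; lra.
have gpos x : 0 < x -> x <= m -> 0 < g x.
  move=> x0 xm; have := H x; rewrite /ball/= sub0r normrN gtr0_norm// (le_lt_trans xm)// gt_eqF//.
  rewrite addr0 g0 subr0 [x *: 1]mulr1 => /(_ isT isT).
  by rewrite pmulr_rgt0// invr_gt0.
have [] := @MVT _ f g 0 m m0 (fun x _ => df x).
  by apply: continuous_subspaceT => x; apply/differentiable_continuous/derivable1_diffP; have [] := df x.
move=> y; rewrite in_itv/= => /andP[y0 ym]; rewrite subr0 => E.
have := fmax m; rewrite gtr0_norm// => /(_ md); rewrite -subr_le0 E leNgt.
by rewrite mulr_gt0// gpos// ltW.
Qed.

Context {n : nat}.
Local Notation E := 'rV[R]_n.+1.
Local Notation e i := (delta_mx 0 i : E).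

Lemma continuous_coord i : continuous (fun z : E => z 0 i).
Proof. exact: coord_continuous. Qed.

Lemma continuous_sqnorm (k : 'I_n.+1 -> R) : continuous (fun z : E => \sum_i k i * z 0 i ^+ 2).
Proof.
apply: cont_sum => i; apply: contM; first exact: cont_cst.
by under eq_fun do rewrite expr2; apply: contM; exact: continuous_coord.
Qed.

Lemma compact_box (lo hi : 'I_n.+1 -> R) :
  compact [set z : E | forall i, lo i <= z 0 i <= hi i].
Proof.
have := @rV_compact R n.+1 (fun i => `[lo i, hi i]) (fun i => @segment_compact _ _ _).
by congr compact; apply/seteqP; split => z /= H i; have := H i; rewrite in_itv.
Qed.

(** Weak maximum principle for subharmonic functions. Adding eps |z|^2 makes the sum of the second
    derivatives strictly positive, which excludes an interior maximum. *)
Lemma max_principle (lo hi : 'I_n.+1 -> R) (w : E -> R) (w1 w2 : 'I_n.+1 -> E -> R) :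
  continuous w ->
  (forall i z, is_derive z (e i) w (w1 i z)) ->
  (forall i z, is_derive z (e i) (w1 i) (w2 i z)) ->
  (forall z, 0 <= \sum_i w2 i z) ->
  (forall z : E, (forall i, lo i <= z 0 i <= hi i) ->
     (exists i, z 0 i = lo i \/ z 0 i = hi i) -> w z <= 0) ->
  forall z : E, (forall i, lo i <= z 0 i <= hi i) -> w z <= 0.
Proof.
move=> cw dw dw1 w20 bdry z0 z0box; rewrite leNgt; apply/negP => wz0.
pose K := [set z : E | forall i, lo i <= z 0 i <= hi i].
have K0 : K !=set0 by exists z0.
pose Q (z : E) := \sum_i 1 * z 0 i ^+ 2 : R.
have cQ : continuous Q by exact: continuous_sqnorm.
have Q0 z : 0 <= Q z by apply: sumr_ge0 => i _; rewrite mul1r sqr_ge0.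
have [q _ Qmax] := EVT_max_rV K0 (@compact_box lo hi) (continuous_subspaceT cQ).
(* With this eps the perturbation stays below w z0 on the whole box, so the maximum of W cannot lie
   on the boundary, where w <= 0. *)
pose eps := w z0 / (2 * (1 + Q q)).
have q1 : 0 < 1 + Q q by rewrite ltr_pwDl.
have eps0 : 0 < eps by rewrite divr_gt0// mulr_gt0.
pose W (z : E) := w z + eps * Q z.
have cW : continuous W by apply: contD => //; apply: contM => //; exact: cont_cst.
have [b bK Wmax] := EVT_max_rV K0 (@compact_box lo hi) (continuous_subspaceT cW).
have {}bK : forall i, lo i <= b 0 i <= hi i by move: bK; rewrite inE.
have Wb : w z0 <= W b.
  apply: (le_trans _ (Wmax z0 _)); last by rewrite inE.
  by rewrite lerDl mulr_ge0// ltW.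
have binn i : lo i < b 0 i < hi i.
  have [//|nb] := boolP (_ < _ < _); exfalso.
  have bd : w b <= 0.
    apply: bdry => //; exists i; have /andP[] := bK i.
    by rewrite !le_eqVlt => /orP[/eqP e1|l1] /orP[/eqP e2|l2]; auto; move: nb; rewrite l1 l2.
  have Qb : Q b <= Q q by apply: Qmax; rewrite inE.
  have : W b <= eps * Q q.
    by rewrite -[leRHS]add0r lerD// ler_pM2l.
  rewrite leNgt => /negP; apply; apply: lt_le_trans Wb.
  rewrite /eps mulrAC ltr_pdivrMr ?mulr_gt0// ltr_pM2l//.
  by rewrite mulrDr mulr1 mulr2n mulrDl !mul1r; move: (Q0 q); lra.
suff H i : w2 i b + 2 * eps <= 0.
  have : \sum_i (w2 i b + 2 * eps) <= 0 by apply: sumr_le0.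
  rewrite big_split/= sumr_const card_ord leNgt => /negP; apply.
  by apply: ltr_wpDl; rewrite ?w20// pmulrn_lgt0// mulr_gt0.
have QE (h : R) : Q (h *: e i + b) = h ^+ 2 + 2 * h * b 0 i + Q b.
  rewrite /Q (bigD1 i)//= [in RHS](bigD1 i)//= addrA.
  congr (_ + _); first by rewrite !mxE !eqxx/= mulr1n; ring.
  apply: eq_bigr => k ki.
  by rewrite !mxE eqxx (negPf ki)/= mulr0n mulr0 add0r.
pose f (h : R) := w (h *: e i + b) + eps * (h ^+ 2 + 2 * h * b 0 i).
pose g (h : R) := w1 i (h *: e i + b) + eps * (2 * h + 2 * b 0 i).
pose del := Num.min (b 0 i - lo i) (hi i - b 0 i).
have /andP[l1 l2] := binn i.
apply: (@second_derivative_at_max f g _ del).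
- by rewrite lt_min !subr_gt0 l1.
- move=> x.
  rewrite /g; have [d0 <-] := dw i (x *: e i + b).
  have d1 := is_derive_line d0.
  have d2 : is_derive x 1 (fun h : R => eps * (h ^+ 2 + 2 * h * b 0 i)) (eps * (2 * x + 2 * b 0 i)).
    apply: is_derive_eq.
    rewrite /GRing.scale/=; ring.
  exact: is_deriveD.
- have [d0 <-] := dw1 i b.
  have d1 : is_derive (0 : R) 1 (fun h : R => w1 i (h *: e i + b)) ('D_(e i) (w1 i) b).
    by have := @is_derive_line _ _ _ (w1 i) (e i) b 0; rewrite scale0r add0r; apply.
  have d2 : is_derive (0 : R) 1 (fun h : R => eps * (2 * h + 2 * b 0 i)) (2 * eps).
    apply: is_derive_eq.
    rewrite /GRing.scale/=; ring.
  exact: is_deriveD.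
- move=> x xd.
  have : W (x *: e i + b) <= W b.
    apply: Wmax; rewrite inE => k; rewrite !mxE eqxx/=.
    have [->|ki] := eqVneq k i; last by rewrite mulr0n mulr0 add0r.
    move: xd; rewrite lt_min !ltr_norml mulr1; lra.
  rewrite /W QE /f scale0r add0r; lra.
Qed.
End maximum_principle.

(** * Odd differences of harmonic functions by reflection *)

Section reflection_estimate.
Context {R : realType} {n : nat}.
Local Notation E := 'rV[R]_n.+1.
Local Notation e i := (delta_mx 0 i : E).

Definition refl (a : E) : E := a - (2 * a 0 0) *: e 0.

Lemma reflE (a : E) i : refl a 0 i = if i == 0 then - a 0 i else a 0 i.
Proof. by rewrite !mxE eqxx/=; case: eqP => [->|_] /=; ring. Qed.

Lemma continuous_add_refl (c : E) : continuous (fun a => c + refl a).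
Proof.
apply: contDv; first exact: cont_cstv.
apply: contDv; first exact: cont_id.
apply/contNv/contZv/contM; [exact: cont_cst|exact: continuous_coord].
Qed.

Variables (u : E -> R) (u1 u2 : 'I_n.+1 -> E -> R).
Hypothesis cu : continuous u.
Hypothesis du : forall i z, is_derive z (e i) u (u1 i z).
Hypothesis du1 : forall i z, is_derive z (e i) (u1 i) (u2 i z).
Hypothesis harm : forall z, \sum_i u2 i z = 0.

Lemma refl_line i (h : R) (z c : E) :
  c + refl (h *: e i + z) = h *: (if i == 0 then - e i else e i) + (c + refl z).
Proof.
rewrite [RHS]addrCA; congr (_ + _); apply/rowP => k.
rewrite reflE [in RHS]mxE reflE !mxE (fun_if (fun M : E => M 0 k)) !mxE !eqxx/=.
case: (altP (i =P 0)) => [->|i0]; case: (altP (k =P 0)) => [->|k0] /=.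
- by ring.
- by ring.
- by rewrite eq_sym (negPf i0)/=; ring.
- by ring.
Qed.

(* Compare the odd part of [u] with the barrier
   [K (sum_(i > 0) a_i^2 + a_0 ((n+1) r - n a_0))], harmonic and at least [2 M] on
   the faces of the half box other than [a_0 = 0]. *)
Lemma harmonic_odd_difference (c : E) (r M t : R) : 0 < r ->
  (forall z : E, (forall i, `|z 0 i - c 0 i| <= r) -> `|u z| <= M) ->
  0 <= t <= r ->
  u (c + t *: e 0) - u (c - t *: e 0) <= 2 * (n.+1)%:R * M * t / r.
Proof.
move=> r0 uM /andP[t0 tr].
(* Normalised so that K r^2 = 2 M, the largest possible value of u(c + a) - u(c + refl a). *)
pose K := 2 * M / r ^+ 2.
have M0 : 0 <= M.
  by apply: le_trans (uM c _) => // i; rewrite subrr normr0 ltW.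
have K0 : 0 <= K by rewrite /K divr_ge0 ?sqr_ge0// mulr_ge0.
have Kr : K * r ^+ 2 = 2 * M by rewrite /K divfK// expf_neq0// gt_eqF.
pose kap (i : 'I_n.+1) := if i == 0 then - (K * n%:R) else K.
pose psi (a : E) := \sum_i kap i * a 0 i ^+ 2 + K * (n.+1)%:R * r * a 0 0.
pose w (a : E) := u (c + a) - u (c + refl a) - psi a.
have psiE (a : E) : psi a = K * (\sum_(i | i != 0) a 0 i ^+ 2 + a 0 0 * (n.+1%:R * r - n%:R * a 0 0)).
  rewrite /psi (bigD1 0)//= /kap eqxx mulrDr mulr_sumr addrAC addrC; congr (_ + _).
    by apply: eq_bigr => i /negPf ->.
  by ring.
pose sg (i : 'I_n.+1) : R := if i == 0 then - 1 else 1.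
pose w1 i (a : E) := u1 i (c + a) - sg i * u1 i (c + refl a)
   - (kap i * 2 * a 0 i + K * n.+1%:R * r * (i == 0)%:R).
pose w2 i (a : E) := u2 i (c + a) - u2 i (c + refl a) - kap i * 2.
have dline (f : E -> R) i (df : E -> R) (a : E) :
    (forall z, is_derive z (e i) f (df z)) ->
    is_derive a (e i) (fun a => f (c + refl a)) (sg i * df (c + refl a)).
  move=> H; apply: (is_derive_comp_affine (phi := fun a => c + refl a) (v' := if i == 0 then - e i else e i)).
    by move=> h; exact: refl_line.
  rewrite /sg; case: eqP => _; last by rewrite mul1r.
  by rewrite mulN1r; exact: is_derive_opp_dir.
have dshift (f : E -> R) i (df : E -> R) (a : E) :
    (forall z, is_derive z (e i) f (df z)) ->
    is_derive a (e i) (fun a => f (c + a)) (df (c + a)).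
  move=> H; apply: (is_derive_comp_affine (phi := fun a => c + a) (v' := e i)) => //.
  by move=> h; rewrite addrCA.
have dpsi i (a : E) : is_derive a (e i) psi (kap i * 2 * a 0 i + K * n.+1%:R * r * (i == 0)%:R).
  have dc k := is_derive_coord a (e i) k.
  have dk k : is_derive a (e i) (fun a : E => kap k * a 0 k ^+ 2) (kap k * (2 * a 0 k * (e i) 0 k)).
    exact: (is_deriveZ (kap k) (is_deriveX 2 (dc k))).
  have ds := is_derive_bigsum (index_enum _) dk.
  have d0 : is_derive a (e i) (fun a : E => K * (n.+1)%:R * r * a 0 0) (K * n.+1%:R * r * (e i) 0 0).
    exact: (is_deriveZ (K * (n.+1)%:R * r) (dc 0)).
  apply: (is_derive_eq (is_deriveD ds d0)).
  rewrite (bigD1 i)//= big1 ?addr0; last first.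
    by move=> k ki; rewrite mxE (negPf ki) andbF !mulr0.
  rewrite !mxE !eqxx/= [0 == i]eq_sym; ring.
have dw i a : is_derive a (e i) w (w1 i a).
  exact: (is_deriveB (is_deriveB (dshift _ i _ a (du i)) (dline _ i _ a (du i))) (dpsi i a)).
have dw1 i a : is_derive a (e i) (w1 i) (w2 i a).
  have d1 := dshift _ i _ a (du1 i).
  have d2 := is_deriveZ (sg i) (dline _ i _ a (du1 i)).
  have d3 := is_deriveZ (kap i * 2) (is_derive_coord a (e i) i).
  have d4 := is_deriveD d3 (is_derive_cst (K * n.+1%:R * r * (i == 0)%:R) a (e i)).
  apply: (is_derive_eq (is_deriveB (is_deriveB d1 d2) d4)).
  rewrite /w2 /GRing.scale/= !mxE !eqxx /sg; case: eqP => _ /=; ring.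
have cw : continuous w.
  apply: contB.
    apply: contB; first exact: continuous_translation.
    move=> a; apply: (@continuous_comp _ _ _ (fun a => c + refl a)); last exact: cu.
    exact: continuous_add_refl.
  apply: contD; first exact: continuous_sqnorm.
  by apply: contM; [exact: cont_cst|exact: continuous_coord].
have w20 a : \sum_i w2 i a = 0.
  rewrite /w2 !sumrB !harm subrr sub0r -mulr_suml (bigD1 0)//= /kap eqxx.
  rewrite (eq_bigr (fun=> K)); last by move=> i /negPf ->.
  by rewrite sumr_const cardC1 card_ord/= -[K *+ n]mulr_natr addNr mul0r oppr0.
(* Half of the cube: on the face a_0 = 0 the reflection is the identity, so the odd part of u
   vanishes there. *)
pose lo (i : 'I_n.+1) := if i == 0 then 0 else - r.
have inbox (a : E) : (forall i, lo i <= a 0 i <= r) -> `|u (c + a)| <= M /\ `|u (c + refl a)| <= M.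
  move=> H; split; apply: uM => i; have := H i; rewrite mxE ?reflE addrAC subrr add0r /lo ler_norml;
  case: eqP => _; move: r0; lra.
have wbd (a : E) : (forall i, lo i <= a 0 i <= r) -> (exists i, a 0 i = lo i \/ a 0 i = r) -> w a <= 0.
  move=> abox [i ai].
  have /andP[a0 ar] : 0 <= a 0 0 <= r by have := abox 0; rewrite /lo eqxx.
  have S0 : 0 <= \sum_(i | i != 0) a 0 i ^+ 2 by apply: sumr_ge0 => k _; exact: sqr_ge0.
  have T0 : 0 <= a 0 0 * (n.+1%:R * r - n%:R * a 0 0).
    rewrite mulr_ge0// subr_ge0 -natr1 mulrDl mul1r ler_wpDr ?(ltW r0)// ler_wpM2l//.
  have psi0 : 0 <= psi a by rewrite psiE mulr_ge0// addr_ge0.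
  have [ul ur] := inbox a abox.
  have big : 2 * M <= psi a -> w a <= 0.
    by move: ul ur; rewrite /w !ler_norml; lra.
  have [i0|i0] := eqVneq i 0.
    case: ai => [al|al].
      rewrite /w (_ : refl a = a) ?subrr ?sub0r ?oppr_le0//.
      apply/rowP => k; rewrite reflE; case: eqP => // ->.
      by move: al; rewrite i0 /lo eqxx => ->; rewrite oppr0.
    apply: big; rewrite psiE -Kr ler_wpM2l// -[leLHS]add0r lerD//.
    by rewrite -i0 al -natr1; rewrite le_eqVlt; apply/orP; left; apply/eqP; ring.
  apply: big; rewrite psiE -Kr ler_wpM2l// -[leLHS]addr0 lerD//.
  rewrite (bigD1 i)//= -[leLHS]addr0 lerD//; last by apply: sumr_ge0 => k _; exact: sqr_ge0.
  by case: ai => ->; rewrite /lo ?(negPf i0) ?sqrrN.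
have tbox i : lo i <= (t *: e 0) 0 i <= r.
  rewrite !mxE eqxx/= /lo; case: (altP (i =P 0)) => _ /=.
    by rewrite mulr1 t0.
  by rewrite mulr0 oppr_le0 (ltW r0).
have w2ge a : 0 <= \sum_i w2 i a by rewrite w20.
have := max_principle cw dw dw1 w2ge wbd tbox.
rewrite /w psiE big1; last first.
  by move=> i i0; rewrite !mxE eqxx (negPf i0)/= mulr0 expr0n.
have -> : refl (t *: e 0) = - (t *: e 0).
  apply/rowP => k; rewrite reflE !mxE eqxx/=; case: eqP => // /eqP k0.
  by rewrite ?(negPf k0)/= ?mulr0 ?oppr0.
rewrite !mxE !eqxx mulr1 add0r => H.
have KE : 2 * n.+1%:R * M * t / r = K * (t * (n.+1%:R * r)).
  by rewrite /K; field; rewrite gt_eqF.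
(* At a = t e_0 the barrier is linear in t up to a negative quadratic term, which is dropped. *)
have : K * (t * (n.+1%:R * r - n%:R * t)) <= K * (t * (n.+1%:R * r)).
  by rewrite !ler_wpM2l// gerBl mulr_ge0.
rewrite KE; move: H; lra.
Qed.
End reflection_estimate.

(** * Cauchy uniqueness for first-order Clifford systems *)

Section difference_estimate.
Context {R : realType} {n : nat}.
Local Notation E := 'rV[R]_n.+1.
Local Notation e i := (delta_mx 0 i : E).

Definition near_box (z : E) (r : R) (z' : E) := forall i, `|z' 0 i - z 0 i| <= r.

Lemma near_boxD (z z' z'' : E) r r' : near_box z r z' -> near_box z' r' z'' ->
  near_box z (r + r') z''.
Proof.
move=> H H' i; rewrite -(subrK (z' 0 i) (z'' 0 i)) -addrA addrC.
by apply: (le_trans (ler_normD _ _)); rewrite lerD.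
Qed.

Lemma near_boxW (z z' : E) r r' : r <= r' -> near_box z r z' -> near_box z r' z'.
Proof. by move=> rr H i; apply: le_trans rr. Qed.

Lemma near_box_shift (z : E) (s : R) i : near_box z `|s| (s *: e i + z).
Proof.
move=> k; rewrite !mxE addrK eqxx/=; case: eqP => _; rewrite ?mulr1 ?mulr0 ?normr0//.
Qed.

Lemma continuous_near_box (f : E -> R) (z : E) (eta : R) : continuous f -> 0 < eta ->
  exists2 del, 0 < del & forall z', near_box z del z' -> `|f z' - f z| <= eta.
Proof.
move=> cf eta0; have := cf z => /(@cvgrPdist_le _ _ _ (nbhs z)) => /(_ _ eta0).
move=> /nbhs_ballP[d /= d0 H]; exists (d / 2); first by rewrite divr_gt0.
move=> z' zz'; rewrite distrC; apply: H; split=> // i j; rewrite ord1 /ball/=.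
by rewrite distrC (le_lt_trans (zz' j))// ltr_pdivrMr// ltr_pMr// ltr1n.
Qed.

Lemma harmonic_odd_difference_norm (u : E -> R) (u1 u2 : 'I_n.+1 -> E -> R) (c : E) (r M t : R) :
  continuous u -> (forall i z, is_derive z (e i) u (u1 i z)) ->
  (forall i z, is_derive z (e i) (u1 i) (u2 i z)) ->
  (forall z, \sum_i u2 i z = 0) -> 0 < r ->
  (forall z : E, near_box c r z -> `|u z| <= M) -> 0 <= t <= r ->
  `|u (c + t *: e 0) - u (c - t *: e 0)| <= 2 * (n.+1)%:R * M * t / r.
Proof.
move=> cu d1 d2 hu r0 uM tr; rewrite ler_norml; apply/andP; split; last first.
  exact: (harmonic_odd_difference cu d1 d2 hu r0 uM tr).
rewrite lerNl.
have cN : continuous (fun z => - u z) by move=> z; apply: (@cvgN _ _ _ (nbhs z)); exact: cu.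
have d1N i z := is_deriveN (d1 i z).
have d2N i z := is_deriveN (d2 i z).
have huN z : \sum_i - u2 i z = 0 by rewrite sumrN hu oppr0.
have uMN z : near_box c r z -> `|- u z| <= M by move=> zc; rewrite normrN; exact: uM.
have := harmonic_odd_difference cN d1N d2N huN r0 uMN tr.
by rewrite opprB opprK addrC.
Qed.

Context {d : nat}.
Implicit Types (T : 'I_n.+1 -> 'M[R]_d) (h g : 'I_d -> E -> R).

(** The estimate for the harmonic averages does not involve the averaging radius, so it survives the
    limit. The box of size 2 r leaves room for the displacement caused by averaging. *)
Lemma C1sol_odd_difference T T' h (c : E) (r M t : R) b : clifford T T' -> C1sol T h ->
  0 < r -> (forall z, near_box c (2 * r) z -> `|h b z| <= M) -> 0 <= t <= r ->
  `|h b (c + t *: e 0) - h b (c - t *: e 0)| <= 2 * (n.+1)%:R * M * t / r.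
Proof.
move=> TT hS r0 hM tr; have [hC _] := hS; have [ch _] := hC b.
apply/ler_addgt0Pr => eta eta0.
have eta2 : 0 < eta / 2 by rewrite divr_gt0.
have [d1 d10 H1] := continuous_near_box (c + t *: e 0) ch eta2.
have [d2 d20 H2] := continuous_near_box (c - t *: e 0) ch eta2.
(* The n+1 averages together displace a point by at most min(r, d1, d2): the values used stay in the
   larger box and are eta / 2 close at the two points compared. *)
pose rho := Num.min r (Num.min d1 d2) / n.+1%:R.
have rho0 : 0 < rho by rewrite divr_gt0// !lt_min r0 d10.
pose l := enum 'I_n.+1.
have lrho : (size l)%:R * rho = Num.min r (Num.min d1 d2).
  by rewrite size_enum_ord mulrC divfK// pnatr_eq0.
pose u := avgs rho l (h b).
have uC : C1 u by exact: C1_avgs.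
have uj j : C1 ('D_(e j) u).
  by have [+ _] := C1sol_derive_avgs rho0 hS (mem_enum _ j : j \in l); apply.
have := @harmonic_odd_difference_norm u (fun i => 'D_(e i) u) (fun i => 'D_(e i) ('D_(e i) u)) c r M t.
move=> /(_ _ _ _ _ r0 _ tr) H.
have {}H : `|u (c + t *: e 0) - u (c - t *: e 0)| <= 2 * (n.+1)%:R * M * t / r.
  apply: H.
  - by case: uC.
  - by move=> i z; apply: derivableP; have [_ /(_ i)[]] := uC.
  - by move=> i z; apply: derivableP; have [_ /(_ i)[]] := uj i.
  - move=> z; apply: (C1sol_harmonic z b TT rho0 hS); first exact: enum_uniq.
    by move=> i; exact: mem_enum.
  - move=> z zc; rewrite -[u z]subr0; apply: avgs_near => // z' zz'; rewrite subr0.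
    apply: hM; rewrite mulr2n mulrDl mul1r; apply: near_boxD zc _.
    by apply: near_boxW zz'; rewrite lrho ge_min lexx.
have L1 : `|u (c + t *: e 0) - h b (c + t *: e 0)| <= eta / 2.
  apply: avgs_near => // z' zz'; apply: H1; apply: near_boxW zz'.
  by rewrite lrho !ge_min lexx orbT.
have L2 : `|u (c - t *: e 0) - h b (c - t *: e 0)| <= eta / 2.
  apply: avgs_near => // z' zz'; apply: H2; apply: near_boxW zz'.
  by rewrite lrho !ge_min lexx !orbT.
move: H L1 L2; move: (u _) (u _) (h b _) (h b _) (_ / r) => x y x' y' B.
rewrite !ler_norml; lra.
Qed.

(** A forward difference from z is a central one about the midpoint z + (s/2) e_0. The midpoint is
    within r of z, which makes up 3 r together with the box of size 2 r. *)
Lemma C1sol_dq_bound T T' h (z : E) (r s M : R) b : clifford T T' -> C1sol T h ->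
  0 < r -> 0 < s <= 2 * r -> (forall z', near_box z (3 * r) z' -> `|h b z'| <= M) ->
  `|dq s 0 (h b) z| <= n.+1%:R / r * M.
Proof.
move=> TT hS r0 /andP[s0 sr] hM.
pose c := (s / 2) *: e 0 + z.
have := @C1sol_odd_difference T T' h c r M (s / 2) b TT hS r0.
have -> : c + (s / 2) *: e 0 = s *: e 0 + z.
  by rewrite addrAC -scalerDl -splitr.
have -> : c - (s / 2) *: e 0 = z by rewrite addrAC subrr add0r.
move=> H; rewrite /dq normrM gtr0_norm ?invr_gt0// mulrC ler_pdivrMr//.
apply: le_trans (H _ _) _.
- move=> z' zc; apply: hM.
  have -> : 3 * r = r + 2 * r by ring.
  apply: near_boxD zc; apply: near_boxW (near_box_shift z (s / 2) 0).
  by rewrite gtr0_norm ?divr_gt0//; lra.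
- by lra.
- by rewrite le_eqVlt; apply/orP; left; apply/eqP; field; rewrite gt_eqF.
Qed.

Definition time_shift (s : R) h : 'I_d -> E -> R := fun b z => h b (s *: e 0 + z).

Lemma C1sol_time_shift T h s : C1sol T h -> C1sol T (time_shift s h).
Proof.
move=> [hC hT].
have D b j z : is_derive z (e j) (time_shift s h b) ('D_(e j) (h b) (s *: e 0 + z)).
  by apply: is_derive_translation; have [_ /(_ j)[]] := hC b.
split.
  move=> b; have [ch Dh] := hC b; split; first exact: continuous_translation.
  move=> j; split; first by move=> z; have [] := D b j z.
  rewrite (_ : 'D_(e j) (time_shift s h b) = fun z => 'D_(e j) (h b) (s *: e 0 + z)).
    exact: (@continuous_translation _ _ _ ('D_(e j) (h b)) (s *: e 0) (proj2 (Dh j))).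
  by apply/funext => z; have [] := D b j z.
move=> z; rewrite -[RHS](hT (s *: e 0 + z)); apply: eq_bigr => j _.
apply: (congr1 (mulmx^~ (T j))); apply: eq_mx => _ b /=; by have [] := D b j z.
Qed.

Lemma C1sol_iter_dq T h s k : C1sol T h -> C1sol T (fun b => iter k (dq s 0) (h b)).
Proof.
by move=> hS; elim: k => [|k IH] //=; exact: (C1sol_dq s 0 IH).
Qed.

(** Difference quotients of a solution are solutions, so the bound can be iterated; each application
    consumes 3 r of the box. *)
Lemma iter_dq_bound T T' h (z0 : E) (r s M L : R) b k : clifford T T' -> C1sol T h ->
  0 < r -> 0 < s <= 2 * r ->
  (forall z, near_box z0 (L + 3 * k%:R * r) z -> `|h b z| <= M) ->
  forall z, near_box z0 L z -> `|iter k (dq s 0) (h b) z| <= (n.+1%:R / r) ^+ k * M.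
Proof.
move=> TT hS r0 sr; elim: k L => [|k IH] L hM z zL.
  by rewrite expr0 mul1r; apply: hM; rewrite mulr0 mul0r addr0.
rewrite iterS exprS -mulrA.
apply: (C1sol_dq_bound TT (C1sol_iter_dq s k hS) r0 sr) => z' zz'.
apply: (IH (L + 3 * r)); last exact: near_boxD zL zz'.
move=> y yL; apply: hM; apply: near_boxW yL.
by rewrite -natr1; move: r0; lra.
Qed.

Lemma iter_dq_eq0 h b s k : 0 < s -> (forall z : E, z 0 0 <= 0 -> h b z = 0) ->
  forall z : E, z 0 0 <= - (k%:R * s) -> iter k (dq s 0) (h b) z = 0.
Proof.
move=> s0 h0; elim: k => [|k IH] z zk; first by apply: h0; move: zk; rewrite mul0r oppr0.
move: zk; rewrite -natr1 mulrDl mul1r => zk.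
rewrite iterS /dq !IH ?subrr ?mulr0//; first by lra.
by rewrite !mxE eqxx mulr1; lra.
Qed.

(* Every lower difference vanishes at time [- k s], so each summation costs only
   a factor [s] and a doubling per step. *)
Lemma iter_dq_sum h b s k i (z : E) (B : R) (J j : nat) : 0 < s -> 0 <= B ->
  (forall z : E, z 0 0 <= 0 -> h b z = 0) -> (i <= k)%N -> z 0 0 = - (k%:R * s) ->
  (forall j, (j <= J)%N -> `|iter k (dq s 0) (h b) ((j%:R * s) *: e 0 + z)| <= B) ->
  (j <= J)%N ->
  `|iter (k - i) (dq s 0) (h b) ((j%:R * s) *: e 0 + z)| <= 2 ^+ j * s ^+ i * B.
Proof.
move=> s0 B0 h0 + zk HB; elim: i j => [|i IH] j ik jJ.
  rewrite subn0 expr0 mulr1; apply: (le_trans (HB j jJ)).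
  by rewrite ler_peMl// exprn_ege1// ler1n.
elim: j jJ => [|j IHj] jJ.
  rewrite mul0r scale0r add0r iter_dq_eq0 ?normr0//.
    by rewrite !mulr_ge0// exprn_ge0// ltW.
  by rewrite zk lerN2 ler_pM2r// ler_nat leq_subr.
set f := iter (k - i.+1) (dq s 0) (h b).
(* One step of discrete integration; both summands obey the same bound, whence the factor 2 per
   step. *)
have -> : f ((j.+1%:R * s) *: e 0 + z) = f ((j%:R * s) *: e 0 + z) +
    s * iter (k - i) (dq s 0) (h b) ((j%:R * s) *: e 0 + z).
  have -> : (k - i = (k - i.+1).+1)%N by rewrite subnSK.
  rewrite iterS -/f /dq mulVKf ?gt_eqF// addrCA subrr addr0 addrA -scalerDl.
  by rewrite -natr1 mulrDl mul1r [s + _]addrC.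
apply: (le_trans (ler_normD _ _)).
have H1 := IHj (ltnW jJ).
have H2 := IH j (ltnW ik) (ltnW jJ).
have -> : 2 ^+ j.+1 * s ^+ i.+1 * B = 2 ^+ j * s ^+ i.+1 * B + s * (2 ^+ j * s ^+ i * B).
  by rewrite !exprS; ring.
by rewrite lerD// normrM gtr0_norm// ler_pM2l.
Qed.

(** With s the time of z, a grid of 2 k steps of size s/k leads from time -s, where g and its
    differences of order at most k vanish, up to z. Since 2 s <= 1, the grid stays within distance 1
    of z; the k differences on cubes of size 1/k consume 3 more, hence the box of size 4. *)
Lemma C1sol_small_time T T' g b : clifford T T' -> C1sol T g ->
  (forall z : E, z 0 0 <= 0 -> g b z = 0) ->
  forall z : E, z 0 0 <= (8 * n.+1%:R)^-1 -> g b z = 0.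
Proof.
move=> TT gS g0 z zs; have [/g0//|s0] := leP (z 0 0) 0.
pose s := z 0 0; have [gC _] := gS; have [cg _] := gC b.
have [M HM] : exists M, forall z', near_box z 4 z' -> `|g b z'| <= M.
  have K0 : [set z' : E | forall i, z 0 i - 4 <= z' 0 i <= z 0 i + 4] !=set0.
    by exists z => i /=; lra.
  have [c _ Hc] := EVT_max_rV K0 (@compact_box _ _ (fun i => z 0 i - 4) (fun i => z 0 i + 4))
    (continuous_subspaceT (cont_norm cg)).
  exists `|g b c| => z' zz'; apply: Hc; rewrite inE => i /=.
  by have := zz' i; rewrite ler_norml; lra.
have M0 : 0 <= M by apply: le_trans (HM z _) => // i; rewrite subrr normr0.
have n0 : (0 : R) < n.+1%:R by rewrite ltr0n.
have s1 : 8 * n.+1%:R * s <= 1.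
  by move: zs; rewrite -[_^-1]mul1r ler_pdivlMr ?mulr_gt0// mulrC.
have s4 : s <= 1 / 8.
  have : (1 : R) <= n.+1%:R by rewrite ler1n.
  move: s1 s0; rewrite -/s; nra.
have bound k : (0 < k)%N -> `|g b z| <= M * (1 / 2) ^+ k.
  move=> k0; have kR : (0 : R) < k%:R by rewrite ltr0n.
  pose sg := s / k%:R.
  have sg0 : 0 < sg by rewrite divr_gt0.
  have ksg : k%:R * sg = s by rewrite /sg mulrC divfK// gt_eqF.
  pose z1 := (- (2 * s)) *: e 0 + z.
  have r0 : (0 : R) < k%:R^-1 by rewrite invr_gt0.
  have sgr : 0 < sg <= 2 * k%:R^-1.
    by rewrite sg0 /sg ler_pM2r//; lra.
  have B0 : 0 <= (n.+1%:R / k%:R^-1) ^+ k * M.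
    by rewrite mulr_ge0// exprn_ge0// divr_ge0// ltW.
  have := @iter_dq_sum g b sg k k z1 _ (2 * k) (2 * k) sg0 B0 g0 (leqnn k) _ _ (leqnn _).
  rewrite subnn natrM -mulrA ksg addrA -scalerDl subrr scale0r add0r.
  move=> H; apply: le_trans (H _ _) _.
  - by rewrite !mxE eqxx mulr1 -/s; ring.
  - move=> j j2; apply: (iter_dq_bound (z0 := z) (L := 1) TT gS r0 sgr).
      move=> z' zz'; apply: HM; apply: near_boxW zz'.
      by rewrite -mulrA divff ?gt_eqF//; lra.
    rewrite addrA -scalerDl; apply: near_boxW (near_box_shift _ _ _).
    have jb : (j%:R : R) <= 2 * k%:R by rewrite -natrM ler_nat.
    have jb0 : (0 : R) <= j%:R by [].
    have : j%:R * sg <= 2 * s by rewrite -ksg mulrA ler_pM2r.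
    have : 0 <= j%:R * sg by rewrite mulr_ge0// ltW.
    by rewrite ler_norml; move: s4 s0; rewrite -/s; lra.
  - have XE : 2 ^+ 2 * sg * (n.+1%:R / k%:R^-1) = 4 * n.+1%:R * s.
      by rewrite /sg; field; rewrite gt_eqF.
    rewrite exprM mulrA -!exprMn XE mulrC ler_wpM2l//.
    apply: lerXn2r; rewrite ?nnegrE//; last by move: s1; lra.
    by rewrite !mulr_ge0// ltW.
apply/eqP; rewrite -normr_le0; apply/ler_addgt0Pr => eta eta0; rewrite add0r.
(* This k satisfies M <= eta k, and k <= 2^k then brings M / 2^k below eta; the successor makes k
   positive, as [bound] requires. *)
pose k := (Num.bound (M / eta)).+1.
apply: le_trans (bound k isT) _.
have kM : M <= eta * k%:R.
  rewrite mulrC -ler_pdivrMr//; apply: (le_trans (ltW (archi_boundP _))); last by rewrite ler_nat.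
  by rewrite divr_ge0// ltW.
have k2 : (k%:R : R) <= 2 ^+ k by rewrite -natrX ler_nat ltnW// ltn_expl.
rewrite expr_div_n expr1n mul1r ler_pdivrMr ?exprn_gt0//.
by apply: (le_trans kM); rewrite ler_pM2l.
Qed.

End difference_estimate.

(** * Extension by zero and propagation of the vanishing *)

Section extension_by_zero.
Context {R : realType} {n : nat}.
Local Notation E := 'rV[R]_n.+1.
Local Notation e i := (delta_mx 0 i : E).

Definition cut (f : E -> R) (z : E) := if 0 < z 0 0 then f z else 0.

(** [cut f] is f composed with the continuous projection that replaces z_0 by max(z_0, 0). *)
Lemma continuous_cut (f : E -> R) : continuous f ->
  (forall z : E, z 0 0 = 0 -> f z = 0) -> continuous (cut f).
Proof.
move=> cf f0.
pose p (z : E) := z + ((`|z 0 0| - z 0 0) / 2) *: e 0.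
have -> : cut f = f \o p.
  apply/funext => z; rewrite /cut /p/=; case: ltP => z0.
    by rewrite gtr0_norm// subrr mul0r scale0r addr0.
  by rewrite f0// !mxE eqxx ler0_norm//=; field.
move=> z; apply: continuous_comp; last exact: cf.
apply: contDv; first exact: cont_id.
apply: contZv; apply: contM; last exact: cont_cst.
apply: contB; last exact: continuous_coord.
by apply: cont_norm; exact: continuous_coord.
Qed.

(** Off the hyperplane z_0 = 0, [cut f] agrees locally with f or with 0. On it, each difference
    quotient is 0 or that of f, which tends to 0. *)
Lemma is_derive_cut (f : E -> R) i (z : E) :
  derivable f z (e i) -> (z 0 0 = 0 -> f z = 0) -> (z 0 0 = 0 -> 'D_(e i) f z = 0) ->
  is_derive z (e i) (cut f) (cut ('D_(e i) f) z).
Proof.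
have cc := @continuous_coord R n 0; move=> df f0 df0; rewrite {2}/cut; case: ltgtP => z0 /=.
- apply: (@near_eq_is_derive _ _ _ f); last exact: derivableP.
  have : \forall y \near z, 0 < (y : E) 0 0 by apply: (cvgr_gt (z 0 0) (cc z)).
  by apply: (@filterS _ (nbhs z)) => y y0; rewrite /cut y0.
- apply: (@near_eq_is_derive _ _ _ (cst 0)).
  have : \forall y \near z, (y : E) 0 0 < 0 by apply: (cvgr_lt (z 0 0) (cc z)).
  by apply: (@filterS _ (nbhs z)) => y y0; rewrite /cut ltNge ltW.
have L : (fun h : R => h^-1 *: ((cut f \o shift z) (h *: e i) - cut f z)) @ 0^' --> (0 : R).
  have dl : (fun h : R => h^-1 *: ((f \o shift z) (h *: e i) - f z)) @ 0^' --> 'D_(e i) f z.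
    exact: df.
  rewrite (df0 (esym z0)) in dl.
  apply/cvgr0Pnorm_le => eta eta0; near=> h.
  have : `|h^-1 *: ((f \o shift z) (h *: e i) - f z)| <= eta.
    by near: h; exact: (cvgr0_norm_le _ dl _ eta0).
  apply: le_trans; rewrite /cut -z0 ltxx subr0 (f0 (esym z0)) subr0/=.
  by case: ifP => // _; rewrite [_ *: 0]mulr0 normr0.
split; first by apply/cvg_ex; exists 0.
exact: cvg_lim L.
Unshelve. all: by end_near. Qed.

Context {d : nat}.
Implicit Types (T : 'I_n.+1 -> 'M[R]_d) (h g : 'I_d -> E -> R).

(** The Clifford relation at s = t = 0 says T_0 T'_0 = 1, so the hyperplane z_0 = 0 is
    noncharacteristic: once the tangential derivatives are zero, the system forces the normal one to
    be zero. *)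
Lemma C1sol_normal_derive T T' h : clifford T T' -> C1sol T h ->
  (forall b (z : E), z 0 0 = 0 -> h b z = 0) ->
  forall i b (z : E), z 0 0 = 0 -> 'D_(e i) (h b) z = 0.
Proof.
move=> TT [hC hT] h0.
have tangent i b (z : E) : i != 0 -> z 0 0 = 0 -> 'D_(e i) (h b) z = 0.
  move=> i0 z0; have [_ /(_ i)[dh _]] := hC b.
  have := is_derive_line (dh (0 *: e i + z)).
  rewrite (_ : (fun s : R => h b (s *: e i + z)) = cst 0); last first.
    apply/funext => s; rewrite h0// mxE z0 mxE mxE /= eq_sym (negPf i0).
    by rewrite mulr0 addr0.
  by rewrite scale0r add0r => -[_ <-]; rewrite derive_cst.
move=> i b z z0; have [->|i0] := eqVneq i 0; last exact: tangent.
have T1 : T 0 *m T' 0 = 1%:M.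
  have := TT 0 0; rewrite eqxx -mulr2n -scaler_nat => H.
  apply: (@scalerI _ _ 2) => //; rewrite H.
  by rewrite scale_scalar_mx mulr1.
pose W : 'rV[R]_d := \row_b 'D_(e 0) (h b) z.
have W0 : W *m T 0 = 0.
  rewrite -[RHS](hT z) (bigD1 0)//= big1 ?addr0// => j j0.
  rewrite (_ : \row__ _ = 0) ?mul0mx//.
  by apply/rowP => c; rewrite mxE [RHS]mxE; exact: tangent.
have : W = 0 by rewrite -[W]mulmx1 -T1 mulmxA W0 mul0mx.
by move=> /rowP/(_ b); rewrite mxE [RHS]mxE.
Qed.

(* On the hyperplane the tangential derivatives vanish, hence by the system the
   normal one does too: extending by zero stays C^1. *)
Lemma C1sol_cut T T' h : clifford T T' -> C1sol T h ->
  (forall b (z : E), z 0 0 = 0 -> h b z = 0) -> C1sol T (fun b => cut (h b)).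
Proof.
move=> TT hS h0; have Dh0 := C1sol_normal_derive TT hS h0; have [hC hT] := hS.
have D b i z : is_derive z (e i) (cut (h b)) (cut ('D_(e i) (h b)) z).
  have [_ /(_ i)[dh _]] := hC b.
  by apply: is_derive_cut; [exact: dh|exact: h0|exact: Dh0].
split.
  move=> b; have [ch Dh] := hC b; split; first by apply: continuous_cut => //; exact: h0.
  move=> i; split; first by move=> z; have [] := D b i z.
  rewrite (_ : 'D_(e i) (cut (h b)) = cut ('D_(e i) (h b))); last first.
    by apply/funext => z; have [] := D b i z.
  by apply: continuous_cut; [exact: (proj2 (Dh i))|exact: Dh0].
move=> z; have [z0|z0] := ltP 0 (z 0 0).
  rewrite -[RHS](hT z); apply: eq_bigr => j _; apply: (congr1 (mulmx^~ (T j))).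
  by apply: eq_mx => _ b /=; have [_ ->] := D b j z; rewrite /cut z0.
apply: big1 => j _; rewrite (_ : \row__ _ = 0) ?mul0mx//.
by apply/rowP => c; rewrite mxE [RHS]mxE; have [_ ->] := D c j z; rewrite /cut ltNge z0.
Qed.

(** The slab on which vanishing propagates has a width depending only on n, so finitely many time
    translations reach any point. *)
Lemma C1sol_support T T' g b : clifford T T' -> C1sol T g ->
  (forall z : E, z 0 0 <= 0 -> g b z = 0) -> forall z, g b z = 0.
Proof.
move=> TT gS g0; pose s : R := (8 * n.+1%:R)^-1.
have s0 : 0 < s by rewrite invr_gt0 mulr_gt0.
have H N : forall z : E, z 0 0 <= N%:R * s -> g b z = 0.
  elim: N => [|N IH] z; first by rewrite mul0r; exact: g0.
  rewrite -natr1 mulrDl mul1r => zN.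
  have := C1sol_small_time (b := b) TT (C1sol_time_shift (N%:R * s) gS).
  move=> /(_ _ ((- (N%:R * s)) *: e 0 + z)).
  rewrite /time_shift addrA -scalerDl subrr scale0r add0r; apply.
    by move=> y y0; apply: IH; rewrite !mxE eqxx mulr1 gerDl.
  by rewrite !mxE eqxx mulr1 -/s; lra.
move=> z; apply: (H (Num.bound (`|z 0 0| / s))).
apply: (le_trans (ler_norm _)); rewrite -ler_pdivrMr//.
by apply/ltW/archi_boundP; rewrite divr_ge0// ltW.
Qed.

Theorem C1sol_cauchy_unique T T' h : clifford T T' -> C1sol T h ->
  (forall b (z : E), z 0 0 = 0 -> h b z = 0) ->
  forall b (z : E), 0 < z 0 0 -> h b z = 0.
Proof.
move=> TT hS h0 b z z0.
have H (y : E) : y 0 0 <= 0 -> cut (h b) y = 0 by move=> y0; rewrite /cut ltNge y0.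
have := C1sol_support TT (C1sol_cut TT hS h0) H z.
by rewrite /cut z0.
Qed.

End extension_by_zero.

(** * Polynomial maps *)

Section vector_derivatives.
Context {R : realType} {V : normedModType R} {d : nat}.
Implicit Types (F : V -> 'rV[R]_d) (z v : V).

Lemma is_derive_rowP F z v (dF : 'rV[R]_d) :
  is_derive z v F dF <-> forall b, is_derive z v (fun y => F y 0 b) (dF 0 b).
Proof.
split=> [[d0 <-] b|H].
  rewrite derive_mx// mxE; apply: derivableP.
  by move/derivable_mxP : d0; apply.
have d0 : derivable F z v.
  by apply/derivable_mxP => i b; rewrite ord1; have [] := H b.
split=> //; rewrite derive_mx//; apply/rowP => b; rewrite mxE.
by have [] := H b.
Qed.

Lemma is_derive_scale (k : V -> R) F z v (dk : R) (dF : 'rV[R]_d) :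
  is_derive z v k dk -> is_derive z v F dF ->
  is_derive z v (fun y => k y *: F y) (k z *: dF + dk *: F z).
Proof.
move=> Hk /is_derive_rowP HF; apply/is_derive_rowP => b.
have -> : (fun y => (k y *: F y) 0 b) = (k * (fun y => F y 0 b)).
  by apply/funext => y; rewrite mxE.
apply: (is_derive_eq (is_deriveM Hk (HF b))).
by rewrite !mxE /GRing.scale/= [_ * dk]mulrC.
Qed.

Lemma is_derive_mulmx F z v (dF : 'rV[R]_d) (M : 'M[R]_d) :
  is_derive z v F dF -> is_derive z v (fun y => F y *m M) (dF *m M).
Proof.
move=> /is_derive_rowP HF; apply/is_derive_rowP => b.
have -> : (fun y => (F y *m M) 0 b) = (fun y => \sum_a M a b * F y 0 a).
  by apply/funext => y; rewrite mxE; apply: eq_bigr => a _; rewrite mulrC.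
rewrite mxE; under eq_bigr do rewrite mulrC.
by apply: is_derive_bigsum => a; exact: (is_deriveZ (M a b) (HF a)).
Qed.

End vector_derivatives.

Section polynomial_maps.
Context {R : realType} {n d : nat}.
Local Notation E := 'rV[R]_n.
Local Notation e i := (delta_mx 0 i : E).
Implicit Types f g : E -> 'rV[R]_d.

(** [polydeg k f] says that f is polynomial of degree strictly less than k. Index 0 is left to the
    zero map alone, so a derivative lowers the index by one and k derivatives give 0. *)
Inductive polydeg : nat -> (E -> 'rV[R]_d) -> Prop :=
| polydeg0 k : polydeg k (fun=> 0)
| polydegC k c : polydeg k.+1 (fun=> c)
| polydegX k s f : polydeg k f -> polydeg k.+1 (fun y => y 0 s *: f y)
| polydegD k f g : polydeg k f -> polydeg k g -> polydeg k (fun y => f y + g y).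

Lemma polydegS k f : polydeg k f -> polydeg k.+1 f.
Proof.
by elim=> *; [exact: polydeg0|exact: polydegC|exact: polydegX|exact: polydegD].
Qed.

Lemma polydeg_eq0 f : polydeg 0 f -> f = fun=> 0.
Proof.
suff H k g : polydeg k g -> k = 0%N -> g = fun=> 0 by move/H; apply.
elim=> // k' f' g' _ IHf _ IHg k0.
by apply/funext => y; rewrite IHf// IHg// addr0.
Qed.

Lemma polydeg_mulmx k f (M : 'M[R]_d) : polydeg k f -> polydeg k (fun y => f y *m M).
Proof.
elim=> [k'|k' c|k' s f' _ IH|k' f' g' _ IHf _ IHg].
- by under eq_fun do rewrite mul0mx; exact: polydeg0.
- exact: polydegC.
- by under eq_fun do rewrite -scalemxAl; exact: polydegX.
- by under eq_fun do rewrite mulmxDl; exact: polydegD.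
Qed.

Lemma polydegZ k f (a : R) : polydeg k f -> polydeg k (fun y => a *: f y).
Proof.
by move=> fk; under eq_fun do rewrite -mul_mx_scalar; exact: polydeg_mulmx.
Qed.

Lemma polydeg_sum (I : Type) (l : seq I) k (F : I -> E -> 'rV[R]_d) :
  (forall i, polydeg k (F i)) -> polydeg k (fun y => \sum_(i <- l) F i y).
Proof.
move=> H; elim: l => [|i l IH].
  by under eq_fun do rewrite big_nil; exact: polydeg0.
by under eq_fun do rewrite big_cons; exact: polydegD.
Qed.

Lemma continuous_polydeg k f : polydeg k f -> continuous f.
Proof.
elim=> [k'|k' c|k' s f' _ IH|k' f' g' _ IHf _ IHg].
- exact: cont_cstv.
- exact: cont_cstv.
- apply: contZZ => //; exact: coord_continuous.
- exact: contDv.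
Qed.

Lemma is_derive_polydegX (s t : 'I_n) f y (df : 'rV[R]_d) : is_derive y (e t) f df ->
  is_derive y (e t) (fun y : E => y 0 s *: f y) (y 0 s *: df + (s == t)%:R *: f y).
Proof.
move=> H; have := is_derive_scale (is_derive_coord y (e t) s) H.
by rewrite mxE.
Qed.

Lemma derivable_polydeg k f y s : polydeg k f -> derivable f y (e s).
Proof.
elim=> [k'|k' c|k' s' f' _ IH|k' f' g' _ IHf _ IHg].
- exact: derivable_cst.
- exact: derivable_cst.
- by have [] := is_derive_polydegX s' (derivableP IH).
- exact: derivableD.
Qed.

Lemma derive_polydegX k (s t : 'I_n) f : polydeg k f ->
  'D_(e t) (fun y : E => y 0 s *: f y) = (fun y => y 0 s *: 'D_(e t) f y + (s == t)%:R *: f y).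
Proof.
move=> fk; apply/funext => y.
have D : derivable f y (e t) by exact: derivable_polydeg fk.
by have [] := is_derive_polydegX s (derivableP D).
Qed.

Lemma derive_polydegD k l (t : 'I_n) f g : polydeg k f -> polydeg l g ->
  'D_(e t) (fun y => f y + g y) = (fun y => 'D_(e t) f y + 'D_(e t) g y).
Proof.
move=> fk gl; apply/funext => y.
by apply: deriveD; [exact: (derivable_polydeg fk)|exact: (derivable_polydeg gl)].
Qed.

Lemma polydeg_derive k f t : polydeg k f -> polydeg k.-1 ('D_(e t) f).
Proof.
elim=> [k'|k' c|k' s f' fk IH|k' f' g' fk IHf gk IHg].
- rewrite (_ : 'D_(e t) _ = fun=> 0); first exact: polydeg0.
  by apply/funext => y; exact: derive_cst.
- rewrite (_ : 'D_(e t) _ = fun=> 0); first exact: polydeg0.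
  by apply/funext => y; exact: derive_cst.
- rewrite (derive_polydegX s t fk)/=; apply: polydegD; last exact: polydegZ.
  (* The index 0 is separate because its predecessor is again 0; there the map itself is zero. *)
  case: k' fk IH => [fk _|k' fk IH]; last exact: polydegX.
  rewrite (polydeg_eq0 fk) (_ : (fun y : E => _) = fun=> 0); first exact: polydeg0.
  by apply/funext => y; rewrite derive_cst scaler0.
- by rewrite (derive_polydegD t fk gk); exact: polydegD.
Qed.

(** Induction on the construction of the polynomial. For a product with a coordinate, Leibniz gives
    two terms that exchange roles under s <-> t and one covered by the induction hypothesis. *)
Lemma polydeg_deriveC k f s t : polydeg k f ->
  'D_(e s) ('D_(e t) f) = 'D_(e t) ('D_(e s) f) :> (E -> _).
Proof.
have d0 (c : 'rV[R]_d) (i : 'I_n) : 'D_(e i) (fun _ : E => c) = fun=> 0.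
  by apply/funext => y; exact: derive_cst.
have dd (c : 'rV[R]_d) (i j : 'I_n) : 'D_(e i) ('D_(e j) (fun _ : E => c)) = fun=> 0.
  by rewrite (d0 c j); exact: d0.
elim=> [k'|k' c|k' u f' fk IH|k' f' g' fk IHf gk IHg].
- exact: etrans (dd 0 s t) (esym (dd 0 t s)).
- exact: etrans (dd c s t) (esym (dd c t s)).
- have D2 i j : 'D_(e i) ('D_(e j) (fun y : E => y 0 u *: f' y)) = fun y : E =>
      (y 0 u *: 'D_(e i) ('D_(e j) f') y + (u == i)%:R *: 'D_(e j) f' y)
      + (u == j)%:R *: 'D_(e i) f' y.
    rewrite (derive_polydegX u j fk); apply/funext => y.
    have d1 : derivable ('D_(e j) f') y (e i) by exact: derivable_polydeg (polydeg_derive j fk).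
    have d2 : derivable f' y (e i) by exact: derivable_polydeg fk.
    by have [_] := is_deriveD (is_derive_polydegX u (derivableP d1))
      (is_deriveZ (u == j)%:R (derivableP d2)).
  apply: etrans (D2 s t) _; apply: etrans _ (esym (D2 t s)); apply/funext => y.
  have IHy : 'D_(e s) ('D_(e t) f') y = 'D_(e t) ('D_(e s) f') y.
    exact: (congr1 (fun F : E -> 'rV[R]_d => F y) IH).
  have sw (a b c1 c2 : 'rV[R]_d) : a = b -> (a + c1) + c2 = (b + c2) + c1.
    by move=> ->; rewrite addrAC.
  apply: sw; exact: (congr1 (fun v : 'rV[R]_d => y 0 u *: v) IHy).
- have D2 i j : 'D_(e i) ('D_(e j) (fun y : E => f' y + g' y)) =
      fun y => 'D_(e i) ('D_(e j) f') y + 'D_(e i) ('D_(e j) g') y.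
    rewrite (derive_polydegD j fk gk).
    exact: (derive_polydegD i (polydeg_derive j fk) (polydeg_derive j gk)).
  apply: etrans (D2 s t) _; apply: etrans _ (esym (D2 t s)); apply/funext => y.
  apply: f_equal2.
    exact: (congr1 (fun F : E -> 'rV[R]_d => F y) IHf).
  exact: (congr1 (fun F : E -> 'rV[R]_d => F y) IHg).
Qed.

Definition dirac_op (U : 'I_n -> 'M[R]_d) f y := \sum_s 'D_(e s) f y *m U s.

Lemma polydeg_dirac_op (U : 'I_n -> 'M[R]_d) k f : polydeg k f -> polydeg k.-1 (dirac_op U f).
Proof.
by move=> fk; apply: polydeg_sum => s; apply/polydeg_mulmx/polydeg_derive.
Qed.

(** Second derivatives are symmetric in s and t while the matrices anticommute off the diagonal, so
    mixed terms cancel once the doubled sum is symmetrised. *)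
Lemma dirac_op_sqr (U : 'I_n -> 'M[R]_d) k f y :
  (forall s t, U t *m U s + U s *m U t = - (2 *+ (s == t))%:M) -> polydeg k f ->
  dirac_op U (dirac_op U f) y = - \sum_s 'D_(e s) ('D_(e s) f) y.
Proof.
move=> UU fk.
pose W s t := 'D_(e s) ('D_(e t) f) y.
have WC s t : W s t = W t s.
  exact: (congr1 (fun F : E -> 'rV[R]_d => F y) (polydeg_deriveC s t fk)).
have BE : dirac_op U (dirac_op U f) y = \sum_s \sum_t W s t *m (U t *m U s).
  apply: eq_bigr => s _.
  have D : is_derive y (e s) (dirac_op U f) (\sum_t W s t *m U t).
    apply: is_derive_bigsum => t; apply/is_derive_mulmx/derivableP.
    exact: (derivable_polydeg (polydeg_derive t fk)).
  by have [_ ->] := D; rewrite mulmx_suml; apply: eq_bigr => t _; rewrite mulmxA.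
apply: (@scalerI _ _ 2) => //.
rewrite scaler_nat mulr2n {2}BE exchange_big BE -big_split/=.
rewrite scalerN scaler_sumr -sumrN; apply: eq_bigr => s _.
rewrite -big_split/= (bigD1 s)//= big1 ?addr0.
  by rewrite -mulmxDr UU eqxx mulr1n mulmxN mul_mx_scalar.
move=> t /negPf st; rewrite (WC t s) -mulmxDr UU eq_sym st mulr0n.
by rewrite mulmxN mul_mx_scalar scale0r oppr0.
Qed.

End polynomial_maps.

(** * Alternative algebras *)

Section left_multiplication.
Context {R : realType} {d : nat} (A : altalg R d).
Local Notation "x ** y" := (amul A x y) (at level 40, left associativity).
Implicit Types a x y z : 'rV[R]_d.

Lemma amul0r z : z ** 0 = 0.
Proof.
by have := amulDr A (-1) 0 0 z; rewrite scaler0 addr0 => ->; rewrite scaleN1r addNr.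
Qed.

Lemma amul0l z : 0 ** z = 0.
Proof.
by have := amulDl A (-1) 0 0 z; rewrite scaler0 addr0 => ->; rewrite scaleN1r addNr.
Qed.

Lemma amulZr z (c : R) x : z ** (c *: x) = c *: (z ** x).
Proof. by have := amulDr A c x 0 z; rewrite !addr0 amul0r addr0. Qed.

Lemma amulZl z (c : R) x : (c *: x) ** z = c *: (x ** z).
Proof. by have := amulDl A c x 0 z; rewrite !addr0 amul0l addr0. Qed.

Lemma amulADr z x y : z ** (x + y) = z ** x + z ** y.
Proof. by have := amulDr A 1 x y z; rewrite !scale1r. Qed.

Lemma amulADl z x y : (x + y) ** z = x ** z + y ** z.
Proof. by have := amulDl A 1 x y z; rewrite !scale1r. Qed.

Lemma amulNr z x : z ** (- x) = - (z ** x).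
Proof. by rewrite -scaleN1r amulZr scaleN1r. Qed.

Lemma amul_sumr (I : Type) (l : seq I) (F : I -> 'rV[R]_d) z :
  z ** (\sum_(i <- l) F i) = \sum_(i <- l) z ** F i.
Proof.
by elim: l => [|i l IH]; rewrite ?big_nil ?amul0r// !big_cons amulADr IH.
Qed.

Lemma amul_suml (I : Type) (l : seq I) (F : I -> 'rV[R]_d) z :
  (\sum_(i <- l) F i) ** z = \sum_(i <- l) F i ** z.
Proof.
by elim: l => [|i l IH]; rewrite ?big_nil ?amul0l// !big_cons amulADl IH.
Qed.

Lemma amul_sqr x a : x ** (x ** a) = (x ** x) ** a.
Proof. by apply/esym/eqP; rewrite -subr_eq0 aassoc_xxy. Qed.

(** Linearisation of x(xa) = (xx)a at x + y. It replaces associativity: symmetric products of left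
    multiplications are left multiplications. *)
Lemma amul_jordan x y a : x ** (y ** a) + y ** (x ** a) = (x ** y + y ** x) ** a.
Proof.
have := amul_sqr (x + y) a; rewrite !(amulADr, amulADl) !amul_sqr => H.
apply: (addrI (x ** x ** a)); apply: (addIr (y ** y ** a)).
by rewrite !addrA in H *; rewrite H [_ + y ** x ** a + x ** y ** a]addrAC.
Qed.

Lemma sphereA_sqr x : sphereA A x -> x ** x = - aone A.
Proof.
case; rewrite /atrace /anorm => /eqP; rewrite addrC addr_eq0 => /eqP ->.
by rewrite amulNr => <-; rewrite opprK.
Qed.

(** Matrices act on row vectors from the right, so in [M *m N] the factor M is applied first, in the
    order opposite to that of the algebra. *)
Definition lmul_mx x : 'M[R]_d := \matrix_i (x ** (delta_mx 0 i)).

Lemma mul_lmul_mx x a : a *m lmul_mx x = x ** a.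
Proof.
rewrite mulmx_sum_row [in RHS](row_sum_delta a) amul_sumr.
by apply: eq_bigr => i _; rewrite rowK amulZr.
Qed.

Lemma mx_row_ext (M N : 'M[R]_d) : (forall a : 'rV[R]_d, a *m M = a *m N) -> M = N.
Proof. by move=> H; apply/row_matrixP => i; rewrite !rowE. Qed.

Variables (p q : nat) (v : idx p q -> 'rV[R]_d).
Hypothesis hv : admissible_basis A v.

Lemma admissible_anticomm (s t : idx p q) : s != lshift q ord0 -> t != lshift q ord0 ->
  v s ** v t + v t ** v s = (- 2 *+ (s == t)) *: aone A.
Proof.
case: hv => _ vS vA _ _ s0 t0; have [<-|st] := eqVneq s t.
  by rewrite sphereA_sqr; [rewrite mulr1n scaleNr scaler_nat mulr2n opprD|exact: vS].
by rewrite (vA s t)// addNr mulr0n scale0r.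
Qed.

Variables (w : 'rV[R]_q) (hw : \sum_(j < q) w ord0 j ^+ 2 = 1).

Let rshift_neq0 (j : 'I_q) : rshift p.+1 j != lshift q ord0.
Proof. by rewrite eq_sym eq_lrshift. Qed.

Let lshift_neq0 (s : 'I_p.+1) : s != ord0 -> lshift q s != lshift q ord0.
Proof. by rewrite eq_lshift. Qed.

Lemma omegaM_sqr : omegaM v w ** omegaM v w = - aone A.
Proof.
set om := omegaM v w.
have E1 : om ** om = \sum_i \sum_j (w ord0 i * w ord0 j) *:
    (v (rshift p.+1 i) ** v (rshift p.+1 j)).
  rewrite /om /omegaM amul_suml; apply: eq_bigr => i _.
  by rewrite amul_sumr; apply: eq_bigr => j _; rewrite amulZl amulZr scalerA.
apply: (@scalerI _ _ 2) => //.
rewrite scaler_nat mulr2n {2}E1 exchange_big E1 -big_split/=.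
rewrite (eq_bigr (fun i => (w ord0 i ^+ 2) *: (- 2 *: aone A))).
  by rewrite -scaler_suml hw scale1r scalerN scaleNr.
move=> i _; rewrite -big_split/= (bigD1 i)//= big1 ?addr0.
  by rewrite -scalerDr (admissible_anticomm (rshift_neq0 i) (rshift_neq0 i)) eqxx mulr1n.
move=> j ji; rewrite [w ord0 j * _]mulrC -scalerDr (admissible_anticomm (rshift_neq0 i) (rshift_neq0 j)).
by rewrite eq_rshift eq_sym (negPf ji) mulr0n scale0r scaler0.
Qed.

Lemma omegaM_anticomm s : s != ord0 ->
  omegaM v w ** v (lshift q s) + v (lshift q s) ** omegaM v w = 0.
Proof.
move=> s0; rewrite /omegaM amul_suml amul_sumr -big_split/= big1// => j _.
rewrite amulZl amulZr -scalerDr.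
rewrite (admissible_anticomm (rshift_neq0 j) (lshift_neq0 s0)).
by rewrite eq_rlshift mulr0n scale0r scaler0.
Qed.

Definition omega_mx := lmul_mx (omegaM v w).
Definition unit_mx (s : 'I_p.+1) := lmul_mx (v (lshift q s)).
(* The sign by which [v_s] changes under the anti-involution. *)
Definition csign (s : 'I_p.+1) : R := if s == ord0 then 1 else - 1.

Lemma omega_mx_sqr : omega_mx *m omega_mx = - 1%:M.
Proof.
apply: mx_row_ext => a; rewrite mulmxA !mul_lmul_mx amul_sqr omegaM_sqr.
by rewrite mulmxN mulmx1 -scaleN1r amulZl amul1l scaleN1r.
Qed.

Lemma unit_mx_ord0 : unit_mx ord0 = 1%:M.
Proof.
apply: mx_row_ext => a; rewrite mul_lmul_mx mulmx1.
by case: hv => -> _ _ _ _; exact: amul1l.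
Qed.

Lemma unit_omega_mx s : unit_mx s *m omega_mx = csign s *: (omega_mx *m unit_mx s).
Proof.
rewrite /csign; case: eqP => [->|/eqP s0].
  by rewrite unit_mx_ord0 mul1mx mulmx1 scale1r.
apply: mx_row_ext => a; rewrite -scalemxAr !mulmxA !mul_lmul_mx scaleN1r.
by apply/eqP; rewrite -addr_eq0 amul_jordan omegaM_anticomm// amul0l.
Qed.

(** Matrix form of v_s v_t^c + v_t v_s^c = 2 delta_st. The cases with index 0 are separate because
    v_0 = 1 commutes with the other units instead of anticommuting. *)
Lemma unit_mx_clifford s t :
  unit_mx t *m (csign s *: unit_mx s) + unit_mx s *m (csign t *: unit_mx t) =
  (2 *+ (s == t))%:M.
Proof.
have [->|s0] := eqVneq s ord0.
  rewrite unit_mx_ord0 /csign eqxx scale1r mulmx1 mul1mx.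
  have [<-|t0] := eqVneq ord0 t.
    by rewrite unit_mx_ord0 scale1r mulr1n -raddfD.
  by rewrite /= scaleN1r subrr mulr0n raddf0.
have [->|t0] := eqVneq t ord0.
  rewrite unit_mx_ord0 /csign eqxx (negPf s0) scale1r mulmx1 mul1mx.
  by rewrite scaleN1r addNr mulr0n raddf0.
rewrite /csign (negPf s0) (negPf t0).
apply: mx_row_ext => a; rewrite mulmxDr -!scalemxAr !mulmxA !mul_lmul_mx !scaleN1r -opprD.
rewrite amul_jordan (admissible_anticomm (lshift_neq0 s0) (lshift_neq0 t0)).
rewrite eq_lshift mul_mx_scalar.
rewrite amulZl amul1l -scaleNr; congr (_ *: _).
by case: eqP => _; rewrite ?mulr1n ?mulr0n ?opprK ?oppr0.
Qed.

End left_multiplication.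

(** * The exponential series on slices *)

Section polynomial_fun_degree.
Context {R : realType} {d p : nat}.
Local Notation E := 'rV[R]_p.+1.

Lemma polydegW k l (f : E -> 'rV[R]_d) : (k <= l)%N -> polydeg k f -> polydeg l f.
Proof.
move=> kl fk; rewrite -(subnKC kl) addnC.
by elim: (l - k)%N => // j IH; rewrite addSn; exact: polydegS.
Qed.

Lemma polydeg_polynomial_fun (f : E -> 'rV[R]_d) : polynomial_fun f ->
  exists k, polydeg k f.
Proof.
case=> N [c [e fE]]; have -> : f = fun y => \sum_(i < N) (\prod_(s < p.+1) y ord0 s ^+ e i s) *: c i.
  exact/funext.
have mono i : exists k, polydeg k (fun y : E => (\prod_(s < p.+1) y ord0 s ^+ e i s) *: c i).
  elim: (index_enum _) => [|s l [k IH]].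
    by exists 1%N; under eq_fun do rewrite big_nil; exact: polydegC.
  have [k' H] : exists k', polydeg k' (fun y : E =>
      y 0 s ^+ e i s *: ((\prod_(s <- l) y ord0 s ^+ e i s) *: c i)).
    elim: (e i s) => [|m [k' IHm]].
      by exists k; under eq_fun do rewrite expr0 scale1r.
    exists k'.+1; under eq_fun do rewrite exprS -scalerA.
    exact: polydegX.
  by exists k'; under eq_fun do rewrite big_cons -scalerA.
elim: (index_enum _) => [|i l [k IH]].
  by exists 0%N; under eq_fun do rewrite big_nil; exact: polydeg0.
have [k' ik] := mono i; exists (maxn k' k).
under eq_fun do rewrite big_cons.
by apply: polydegD; [apply: polydegW ik; exact: leq_maxl|apply: polydegW IH; exact: leq_maxr].
Qed.

Lemma polydeg_iter_dirac_op (U : 'I_p.+1 -> 'M[R]_d) k n (f : E -> 'rV[R]_d) :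
  polydeg k f -> polydeg (k - n) (iter n (dirac_op U) f).
Proof.
move=> fk; elim: n => [|n IH]; first by rewrite subn0.
by rewrite iterS subnS; exact: polydeg_dirac_op.
Qed.

(** Two applications of the first-order operator make one negative Laplacian; the degree is tracked
    because the squaring identity is applied to each iterate. *)
Lemma mlapl_pow_dirac (U : 'I_p.+1 -> 'M[R]_d) k j (f : E -> 'rV[R]_d) :
  (forall s t, U t *m U s + U s *m U t = - (2 *+ (s == t))%:M) -> polydeg k f ->
  mlapl_pow j f = iter (2 * j) (dirac_op U) f.
Proof.
move=> UU fk; elim: j => [|j IH] //; rewrite mulnS !iterS -IH.
apply/funext => y; rewrite [RHS](@dirac_op_sqr _ _ _ _ (k - 2 * j)%N)//.
by rewrite IH; exact: polydeg_iter_dirac_op.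
Qed.

Lemma polydeg_lapl k (f : E -> 'rV[R]_d) : polydeg k f -> polydeg k.-2 (fun y => - lapl f y).
Proof.
move=> fk; under eq_fun do rewrite -scaleN1r.
apply/polydegZ/polydeg_sum => s.
exact: (polydeg_derive s (polydeg_derive s fk)).
Qed.

Lemma mlapl_powSr j (f : E -> 'rV[R]_d) :
  mlapl_pow j.+1 f = mlapl_pow j (fun y => - lapl f y).
Proof. exact: iterSr. Qed.

(** A constant matrix commutes with derivatives. This is what lets omega, constant on a slice, be
    moved across the powers of the Laplacian. *)
Lemma mlapl_pow_mulmx k j (f : E -> 'rV[R]_d) (M : 'M[R]_d) : polydeg k f ->
  mlapl_pow j (fun y => f y *m M) = fun y => mlapl_pow j f y *m M.
Proof.
elim: j k f => [|j IH] k f fk; first by [].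
rewrite mlapl_powSr (mlapl_powSr j f).
have DM l (g : E -> 'rV[R]_d) s : polydeg l g ->
    'D_(delta_mx 0 s) (fun y => g y *m M) = fun y : E => 'D_(delta_mx 0 s) g y *m M.
  move=> gl; apply/funext => y; have D : derivable g y (delta_mx 0 s) by exact: derivable_polydeg gl.
  by have [_] := is_derive_mulmx M (derivableP D).
rewrite -(IH _ _ (polydeg_lapl fk)); apply: (congr1 (mlapl_pow j)).
apply/funext => y; rewrite mulNmx; apply: (congr1 -%R).
rewrite /lapl mulmx_suml; apply: eq_bigr => s _.
rewrite /pderiv; have -> : (fun y : E => 'D_(delta_mx 0 s) (fun y0 : E => f y0 *m M) y) =
    fun y : E => 'D_(delta_mx 0 s) f y *m M by exact: DM fk.
exact: (congr1 (fun F : E -> 'rV[R]_d => F y) (DM _ _ s (polydeg_derive s fk))).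
Qed.

End polynomial_fun_degree.

Lemma limn_series_finite {R : realType} {V : normedModType R} (u : nat -> V) K :
  (forall k, (K <= k)%N -> u k = 0) -> limn (series u) = \sum_(k < K) u k.
Proof.
move=> u0; apply: lim_near_cst => //; near=> m.
have Km : (K <= m)%N by near: m; exact: nbhs_infty_ge.
rewrite /series/= (big_cat_nat (n := K))//= big_mkord.
have -> : \sum_(K <= i < m) u i = 0; last by rewrite addr0.
by rewrite big_nat_cond big1// => k /andP[/andP[Kk _] _]; exact: u0.
Unshelve. all: by end_near. Qed.

Lemma sum_even_odd {V : nmodType} (F : nat -> V) K :
  \sum_(n < (2 * K)%N) F n = \sum_(k < K) F (2 * k)%N + \sum_(k < K) F (2 * k).+1.
Proof.
elim: K => [|K IH]; first by rewrite !big_ord0 addr0.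
rewrite mulnS !big_ord_recr/= IH -!addrA; congr (_ + _).
by rewrite addrCA.
Qed.

Section exponential_slice.
Context {R : realType} {d p : nat}.
Local Notation E := 'rV[R]_p.+1.
Variables (F : nat -> E -> 'rV[R]_d) (N : nat).
Hypothesis cF : forall n, continuous (F n).
Hypothesis dF : forall n s y, derivable (F n) y (delta_mx 0 s).
Hypothesis cdF : forall n s, continuous ('D_(delta_mx 0 s) (F n)).
Hypothesis F0 : F N = fun=> 0.

(** Truncated exponential: with F n = B^n f_0 it is exp(r B) f_0. *)
Definition eslice (z : E * R) := \sum_(n < N) (z.2 ^+ n / n`!%:R) *: F n z.1.

Lemma is_derive_eslice_space z s : is_derive z (delta_mx 0 s : E, 0 : R) eslice
  (\sum_(n < N) (z.2 ^+ n / n`!%:R) *: 'D_(delta_mx 0 s) (F n) z.1).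
Proof.
apply: is_derive_bigsum => n.
have d1 : is_derive z (delta_mx 0 s : E, 0 : R) (F n \o fst) ('D_(delta_mx 0 s) (F n) z.1).
  by apply: (is_derive_comp_affine (v' := delta_mx 0 s)) => //; exact/derivableP/dF.
have d2 : is_derive z (delta_mx 0 s : E, 0 : R) ((fun t : R => t ^+ n / n`!%:R) \o snd) 0.
  apply: (is_derive_comp_affine (v' := 0)); last exact: is_derive0.
  by move=> h.
by have := is_derive_scale d2 d1; rewrite scale0r addr0.
Qed.

Lemma is_derive_eslice_time z : is_derive z (0 : E, 1 : R) eslice
  (\sum_(n < N) (z.2 ^+ n / n`!%:R) *: F n.+1 z.1).
Proof.
have H : is_derive z (0 : E, 1 : R) eslice (\sum_(n < N) (n%:R * z.2 ^+ n.-1 / n`!%:R) *: F n z.1).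
  apply: is_derive_bigsum => n.
  have d1 : is_derive z (0 : E, 1 : R) (F n \o fst) 0.
    apply: (is_derive_comp_affine (v' := 0)); last exact: is_derive0.
    by move=> h.
  have d2 : is_derive z (0 : E, 1 : R) ((fun t : R => t ^+ n / n`!%:R) \o snd)
      (n%:R * z.2 ^+ n.-1 / n`!%:R).
    apply: (is_derive_comp_affine (v' := (1 : R))) => //.
    have -> : (fun t : R => t ^+ n / n`!%:R) = n`!%:R^-1 \*: (@id R ^+ n).
      by apply/funext => t; rewrite /= exprfctE mulrC.
    apply: is_derive_eq.
    by rewrite /GRing.scale/= mulr1 mulrC.
  by have := is_derive_scale d2 d1; rewrite scaler0 add0r.
apply: (is_derive_eq H).
(* The constant term in r disappears and the others shift down by one; the extra last term of the
   target contains F N, which is zero. *)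
case: N F0 => [|M] FM; first by rewrite !big_ord0.
rewrite big_ord_recl/= mul0r mul0r scale0r add0r big_ord_recr/= FM scaler0 addr0.
apply: eq_bigr => n _; rewrite /bump/= add1n factS natrM invfM.
congr (_ *: _); rewrite mulrA; congr (_ / _).
by rewrite mulrC mulKf// pnatr_eq0.
Qed.

Lemma continuous_eslice_sum (G : nat -> E -> 'rV[R]_d) : (forall n, continuous (G n)) ->
  continuous (fun z : E * R => \sum_(n < N) (z.2 ^+ n / n`!%:R) *: G n z.1).
Proof.
move=> cG; apply: cont_sumv => n; apply: contZZ.
  apply: contM; last exact: cont_cst.
  move=> z; apply: (@continuous_comp _ _ _ snd (fun t : R => t ^+ n)); first exact: cvg_snd.
  exact: exprn_continuous.
move=> z; apply: (@continuous_comp _ _ _ fst (G n)); first exact: cvg_fst.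
exact: cG.
Qed.

Lemma C1slice_eslice : C1slice eslice.
Proof.
split; first exact: continuous_eslice_sum.
split=> [s|]; split.
- by move=> z; have [] := is_derive_eslice_space z s.
- rewrite (_ : (fun z => _) = fun z => \sum_(n < N) (z.2 ^+ n / n`!%:R) *: 'D_(delta_mx 0 s) (F n) z.1).
    exact: (@continuous_eslice_sum (fun n y => 'D_(delta_mx 0 s) (F n) y) (fun n => @cdF n s)).
  by apply/funext => z; have [] := is_derive_eslice_space z s.
- by move=> z; have [] := is_derive_eslice_time z.
- rewrite (_ : (fun z => _) = fun z => \sum_(n < N) (z.2 ^+ n / n`!%:R) *: F n.+1 z.1).
    exact: (@continuous_eslice_sum (fun n => F n.+1) (fun n => @cF n.+1)).
  by apply/funext => z; have [] := is_derive_eslice_time z.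
Qed.

End exponential_slice.

Lemma cont_pair (T U1 U2 : topologicalType) (f : T -> U1) (g : T -> U2) :
  continuous f -> continuous g -> continuous (fun z => (f z, g z)).
Proof. by move=> cf cg z; apply: cvg_pair; [exact: cf|exact: cg]. Qed.

Lemma C1sol_sub {R : realType} {n d : nat} (T : 'I_n.+1 -> 'M[R]_d)
    (h1 h2 : 'I_d -> 'rV[R]_n.+1 -> R) :
  C1sol T h1 -> C1sol T h2 -> C1sol T (fun b z => h1 b z - h2 b z).
Proof.
move=> [hC1 hT1] [hC2 hT2].
have D b i z : is_derive z (delta_mx 0 i) (fun z => h1 b z - h2 b z)
    ('D_(delta_mx 0 i) (h1 b) z - 'D_(delta_mx 0 i) (h2 b) z).
  have [_ /(_ i)[d1 _]] := hC1 b; have [_ /(_ i)[d2 _]] := hC2 b.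
  exact: is_deriveB (derivableP (d1 z)) (derivableP (d2 z)).
split.
  move=> b; have [c1 D1] := hC1 b; have [c2 D2] := hC2 b.
  split; first exact: contB.
  move=> i; split; first by move=> z; have [] := D b i z.
  rewrite (_ : 'D_(delta_mx 0 i) _ = fun z => 'D_(delta_mx 0 i) (h1 b) z - 'D_(delta_mx 0 i) (h2 b) z).
    exact: (contB (proj2 (D1 i)) (proj2 (D2 i))).
  by apply/funext => z; have [] := D b i z.
move=> z; transitivity (\sum_i ((\row_b 'D_(delta_mx 0 i) (h1 b) z) *m T i -
    (\row_b 'D_(delta_mx 0 i) (h2 b) z) *m T i)); last by rewrite sumrB hT1 hT2 subrr.
apply: eq_bigr => i _.
rewrite -mulmxBl; apply: (congr1 (mulmx^~ (T i))).
apply/rowP => b; rewrite mxE [RHS]mxE mxE [in RHS]mxE mxE.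
by have [_ ->] := D b i z.
Qed.

(** * The monogenic equation on a single slice *)

Section slices.
Context {R : realType} {d : nat} (A : altalg R d) {p q : nat}.
Variables (v : idx p q -> 'rV[R]_d) (hv : admissible_basis A v).
Variables (w : 'rV[R]_q) (hw : \sum_(j < q) w ord0 j ^+ 2 = 1).
Local Notation E := 'rV[R]_p.+1.
Local Notation O := (omega_mx A v w).
Local Notation V := (unit_mx A v).

Definition slice_eq (g : E * R -> 'rV[R]_d) := forall z,
  \sum_(s < p.+1) amul A (v (lshift q s)) ('D_(delta_mx 0 s, 0) g z)
    + amul A (omegaM v w) ('D_((0 : E), (1 : R)) g z) = 0.

(* Coordinate 0 is the radial variable r, coordinate [lift ord0 s] is x_s. *)
Definition slice_mx (i : 'I_p.+2) := if unlift ord0 i is Some s then V s else O.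
Definition slice_conj_mx (i : 'I_p.+2) :=
  if unlift ord0 i is Some s then csign s *: V s else - O.

(** The conjugates are v_s^c = csign s v_s and omega^c = - omega; the mixed relations hold because
    moving omega past v_s produces exactly the sign [csign s]. *)
Lemma slice_clifford : clifford slice_mx slice_conj_mx.
Proof.
have OO := omega_mx_sqr hv hw.
have OV s : O *m (csign s *: V s) = V s *m O.
  by rewrite -scalemxAr (unit_omega_mx hv).
move=> s t; rewrite /slice_mx /slice_conj_mx.
case: (unliftP ord0 s) => [s'|] ->; case: (unliftP ord0 t) => [t'|] ->.
- by rewrite (inj_eq lift_inj); exact: unit_mx_clifford.
- by rewrite eq_sym (negPf (neq_lift _ _)) OV mulmxN subrr mulr0n raddf0.
- by rewrite (negPf (neq_lift _ _)) OV mulmxN addNr mulr0n raddf0.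
- by rewrite eqxx mulmxN OO opprK mulr1n -raddfD.
Qed.

Definition slice_point (z : 'rV[R]_p.+2) : E * R := (\row_s z 0 (lift ord0 s), z 0 ord0).

Lemma slice_pointD (h : R) (x z : 'rV[R]_p.+2) :
  slice_point (h *: x + z) = h *: slice_point x + slice_point z.
Proof.
by rewrite /slice_point !mxE; congr pair; apply/rowP => s; rewrite !mxE.
Qed.

Lemma slice_point_delta i : slice_point (delta_mx 0 i) =
  if unlift ord0 i is Some s then (delta_mx 0 s, 0) else (0, 1).
Proof.
rewrite /slice_point !mxE eqxx/=; case: unliftP => [s|] ->.
  rewrite (negPf (neq_lift _ _)); congr pair; apply/rowP => k.
  by rewrite !mxE eqxx/= (inj_eq lift_inj).
rewrite eqxx; congr pair; apply/rowP => k.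
by rewrite !mxE eqxx.
Qed.

Lemma continuous_slice_point : continuous slice_point.
Proof.
have c1 : continuous (fun z : 'rV[R]_p.+2 => \row_s z 0 (lift ord0 s) : E).
  rewrite (_ : (fun z => _) = fun z : 'rV[R]_p.+2 => \sum_s z 0 (lift ord0 s) *: (delta_mx 0 s : E)).
    by apply: cont_sumv => s; apply: contZv; exact: continuous_coord.
  apply/funext => z; rewrite [LHS]row_sum_delta; apply: eq_bigr => s _.
  by rewrite mxE.
exact: (cont_pair c1 (@continuous_coord _ _ ord0)).
Qed.

Lemma C1sol_slice (g : E * R -> 'rV[R]_d) : C1slice g -> slice_eq g ->
  C1sol slice_mx (fun b z => g (slice_point z) 0 b).
Proof.
move=> [cg [gs [dt ct]]] geq.
pose dir i : E * R := if unlift ord0 i is Some s then (delta_mx 0 s, 0) else (0, 1).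
have dg i z : derivable g z (dir i).
  by rewrite /dir; case: (unlift _ _) => [s|]; [have [+ _] := gs s; apply|exact: dt].
have cdg i : continuous (fun z => 'D_(dir i) g z).
  by rewrite /dir; case: (unlift _ _) => [s|]; [have [_ +] := gs s; apply|exact: ct].
have D b i z : is_derive z (delta_mx 0 i) (fun z => g (slice_point z) 0 b)
    ('D_(dir i) g (slice_point z) 0 b).
  have /is_derive_rowP/(_ b) := derivableP (dg i (slice_point z)).
  apply: is_derive_comp_affine => h.
  by rewrite slice_pointD slice_point_delta.
have cc (G : E * R -> 'rV[R]_d) b : continuous G -> continuous (fun z => G (slice_point z) 0 b).
  move=> cG z.
  apply: (@continuous_comp _ _ _ (fun z => G (slice_point z)) (fun y : 'rV[R]_d => y 0 b)); last exact: coord_continuous.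
  by apply: (@continuous_comp _ _ _ slice_point G); [exact: continuous_slice_point|exact: cG].
split.
  move=> b; split; first exact: cc.
  move=> i; split; first by move=> z; have [] := D b i z.
  rewrite (_ : 'D_(delta_mx 0 i) _ = fun z => 'D_(dir i) g (slice_point z) 0 b).
    exact: (cc (fun z => 'D_(dir i) g z) b (@cdg i)).
  by apply/funext => z; have [] := D b i z.
move=> z; rewrite -[RHS](geq (slice_point z)) big_ord_recl addrC.
have RE i : \row_b 'D_(delta_mx 0 i) (fun z => g (slice_point z) 0 b) z = 'D_(dir i) g (slice_point z).
  by apply/rowP => b; rewrite mxE; have [] := D b i z.
apply: f_equal2; last by rewrite RE /slice_mx /dir unlift_none mul_lmul_mx.
by apply: eq_bigr => s _; rewrite RE /slice_mx /dir liftK mul_lmul_mx.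
Qed.

(** The system is linear, so the difference solves it with zero Cauchy data at r = 0. Positive t is
    enough: every point off r = 0 is reached from its own direction omega. *)
Lemma slice_unique (g1 g2 : E * R -> 'rV[R]_d) :
  C1slice g1 -> slice_eq g1 -> C1slice g2 -> slice_eq g2 ->
  (forall y, g1 (y, 0) = g2 (y, 0)) ->
  forall y t, 0 < t -> g1 (y, t) = g2 (y, t).
Proof.
move=> C1 e1 C2 e2 g0 y t t0; apply/rowP => b; apply/eqP; rewrite -subr_eq0; apply/eqP.
pose z : 'rV[R]_p.+2 := \row_i if unlift ord0 i is Some s then y 0 s else t.
have zE : slice_point z = (y, t).
  rewrite /slice_point !mxE unlift_none; congr pair.
  by apply/rowP => s; rewrite !mxE liftK.
have S := C1sol_sub (C1sol_slice C1 e1) (C1sol_slice C2 e2).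
have := C1sol_cauchy_unique slice_clifford S _ b (z := z).
rewrite zE; apply; last by rewrite mxE unlift_none.
by move=> c y' y'0; rewrite /slice_point y'0 g0 subrr.
Qed.

(** Matrix of a |-> omega (v_s a). Multiplying the slice equation by omega gives d_r f = omega (D
    f), so [dirac_op ck_mx] is the generator B. *)
Definition ck_mx s := V s *m O.

(** Moving the inner omega past the second unit conjugates that unit, and the two omegas then meet
    and give -1; what remains is the relation for the units. *)
Lemma ck_mx_anticomm s t : ck_mx t *m ck_mx s + ck_mx s *m ck_mx t = - (2 *+ (s == t))%:M.
Proof.
have OO := omega_mx_sqr hv hw.
have VOVO a b : ck_mx a *m ck_mx b = - (V a *m (csign b *: V b)).
  rewrite /ck_mx mulmxA -(mulmxA (V a)).
  have -> : O *m V b = csign b *: (V b *m O).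
    rewrite (unit_omega_mx hv) scalerA /csign.
    by case: eqP => _; rewrite ?mulr1 ?mulrNN ?mulr1 scale1r.
  by rewrite scalemxAl mulmxA -!mulmxA OO !mulmxN mulmx1.
by rewrite !VOVO -opprD (unit_mx_clifford hv).
Qed.

Variables (f0 : E -> 'rV[R]_d) (K : nat).
Hypothesis f0K : polydeg K f0.

Definition ck_coef n := iter n (dirac_op ck_mx) f0.

Lemma ck_coef_eq0 n : (K <= n)%N -> ck_coef n = fun=> 0.
Proof.
move=> Kn; apply: polydeg_eq0.
by have := polydeg_iter_dirac_op ck_mx n f0K; rewrite (eqP Kn).
Qed.

Lemma polydeg_diracp : polydeg K.-1 (diracp A v f0).
Proof.
apply: polydeg_sum => s.
rewrite (_ : (fun y => _) = fun y => 'D_(delta_mx 0 s) f0 y *m V s).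
  exact/polydeg_mulmx/polydeg_derive.
by apply/funext => y; rewrite mul_lmul_mx.
Qed.

Lemma ck_coef_even k y : mlapl_pow k f0 y = ck_coef (2 * k) y.
Proof. by rewrite (mlapl_pow_dirac k ck_mx_anticomm f0K). Qed.

(** The first application of B gives omega D f_0, and the remaining 2 k amount to the k-th power of
    the negative Laplacian, past which the constant omega is moved. *)
Lemma ck_coef_odd k y :
  amul A (omegaM v w) (mlapl_pow k (diracp A v f0) y) = ck_coef (2 * k).+1 y.
Proof.
rewrite -mul_lmul_mx /ck_coef iterSr.
rewrite -(mlapl_pow_dirac k ck_mx_anticomm (polydeg_dirac_op ck_mx f0K)).
have -> : dirac_op ck_mx f0 = fun y => diracp A v f0 y *m O.
  apply/funext => x; rewrite /dirac_op /diracp mulmx_suml; apply: eq_bigr => s _.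
  by rewrite /ck_mx mulmxA -mul_lmul_mx.
by rewrite (mlapl_pow_mulmx k O polydeg_diracp).
Qed.

Lemma diracp_eq0 k y : (K <= k)%N -> mlapl_pow k (diracp A v f0) y = 0.
Proof.
move=> Kk; rewrite (mlapl_pow_dirac k ck_mx_anticomm polydeg_diracp).
have H := polydeg_iter_dirac_op ck_mx (2 * k) polydeg_diracp.
rewrite (polydeg_eq0 (polydegW _ H))//.
by rewrite leqn0 subn_eq0 (leq_trans (leq_pred _))// (leq_trans Kk)// leq_pmull.
Qed.

(** For t < 0 the formula uses r = |t| and the direction -w, and the two signs cancel in the odd
    terms. For t = 0 the direction is 0 because 0^-1 = 0, which agrees with the vanishing odd powers
    of t. *)
Lemma CK_slice y t : CK A v f0 (row_mx y (t *: w)) = eslice ck_coef (2 * K) (y, t).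
Proof.
rewrite /CK row_mxKl row_mxKr.
have -> : \sum_(j < q) (t *: w) ord0 j ^+ 2 = t ^+ 2.
  under eq_bigr do rewrite mxE exprMn.
  by rewrite -mulr_sumr hw mulr1.
rewrite sqrtr_sqr (@limn_series_finite _ _ _ K); last first.
  move=> k Kk; rewrite [mlapl_pow _ _ _]ck_coef_even ck_coef_eq0 ?scaler0//.
  by rewrite (leq_trans Kk)// leq_pmull.
rewrite (@limn_series_finite _ _ (fun k => _ *: mlapl_pow k (diracp A v f0) y) K); last first.
  by move=> k Kk; rewrite diracp_eq0// scaler0.
rewrite /eslice (sum_even_odd (fun n => ((y, t).2 ^+ n / n`!%:R) *: ck_coef n (y, t).1))/=.
have t2 k : `|t| ^+ (2 * k) = t ^+ (2 * k) by rewrite !exprM -normrX ger0_norm ?sqr_ge0.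
apply: f_equal2.
  by apply: eq_bigr => k _; rewrite t2 ck_coef_even.
have -> : omegaM v (`|t|^-1 *: (t *: w)) = (`|t|^-1 * t) *: omegaM v w.
  rewrite scalerA /omegaM scaler_sumr; apply: eq_bigr => j _.
  by rewrite mxE scalerA.
rewrite amul_sumr; apply: eq_bigr => k _.
rewrite amulZr amulZl ck_coef_odd scalerA; congr (_ *: _).
have tt : `|t|^-1 * t * `|t| = t.
  have [->|t0] := eqVneq t 0; first by rewrite normr0 !mulr0.
  by rewrite mulrAC mulVf ?mul1r// normr_eq0.
rewrite !exprS t2; move: (t ^+ (2 * k)) (_`!%:R^-1) => P f.
by rewrite -[X in _ = X * P * f]tt; ring.
Qed.

Lemma C1slice_ck : C1slice (eslice ck_coef (2 * K)).
Proof.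
have P n := polydeg_iter_dirac_op ck_mx n f0K.
apply: C1slice_eslice.
- by move=> n; exact: continuous_polydeg (P n).
- by move=> n s y; exact: derivable_polydeg (P n).
- by move=> n s; exact: continuous_polydeg (polydeg_derive s (P n)).
- by apply: ck_coef_eq0; exact: leq_pmull.
Qed.

(** The equation holds term by term: omega times B g equals omega (omega D g) = - D g, which cancels
    D g. *)
Lemma slice_eq_ck : slice_eq (eslice ck_coef (2 * K)).
Proof.
move=> z; have P n := polydeg_iter_dirac_op ck_mx n f0K.
have dP n s y : derivable (ck_coef n) y (delta_mx 0 s) by exact: derivable_polydeg (P n).
have KF : ck_coef (2 * K) = fun=> 0 by apply: ck_coef_eq0; exact: leq_pmull.
have [_ ->] := is_derive_eslice_time KF z.
rewrite (eq_bigr (fun s => \sum_(n < 2 * K) (z.2 ^+ n / n`!%:R) *: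
    ('D_(delta_mx 0 s) (ck_coef n) z.1 *m V s))); last first.
  move=> s _; have [_ ->] := is_derive_eslice_space (2 * K) dP z s.
  rewrite -mul_lmul_mx mulmx_suml; apply: eq_bigr => n _.
  by rewrite -scalemxAl.
rewrite exchange_big/= -mul_lmul_mx mulmx_suml -big_split/= big1// => n _.
rewrite -scaler_sumr -scalemxAl -scalerDr.
have -> : dirac_op ck_mx (ck_coef n) z.1 = (\sum_s 'D_(delta_mx 0 s) (ck_coef n) z.1 *m V s) *m O.
  rewrite /dirac_op mulmx_suml; apply: eq_bigr => s _.
  by rewrite /ck_mx mulmxA.
rewrite -mulmxA (omega_mx_sqr hv hw) mulmxN mulmx1 subrr scaler0 //.
Qed.

End slices.

(** * Existence and uniqueness of the monogenic extension *)

Unset Implicit Arguments.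
Set Strict Implicit.
Local Close Scope classical_set_scope.

Theorem theorem3p5 (R : realType) (d : nat) (A : altalg R d) (hd : (1 < d)%N)
  (p q : nat) (hq : (0 < q)%N) (v : 'I_(p.+1 + q) -> 'rV[R]_d)
  (hv : admissible_basis A v)
  (f0 : 'rV[R]_(p.+1) -> 'rV[R]_d) (hf0 : polynomial_fun f0) :
  (forall y : 'rV[R]_(p.+1), CK A v f0 (row_mx y 0) = f0 y) /\
  gpsm A v (CK A v f0) /\
  (forall g : 'rV[R]_(p.+1 + q) -> 'rV[R]_d,
     gpsm A v g -> (forall y : 'rV[R]_(p.+1), g (row_mx y 0) = f0 y) ->
     g = CK A v f0).
Proof.
have [K f0K] := polydeg_polynomial_fun hf0.
have CKE (w : 'rV[R]_q) (hw : \sum_(j < q) w ord0 j ^+ 2 = 1) :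
    (fun z : 'rV[R]_p.+1 * R => CK A v f0 (row_mx z.1 (z.2 *: w))) =
    eslice (ck_coef A v w f0) (2 * K).
  by apply/funext => -[y t]; exact: CK_slice.
have CK0 (y : 'rV[R]_p.+1) : CK A v f0 (row_mx y 0) = f0 y.
  (* Restriction to r = 0 can be read off on any slice; q > 0 supplies a unit vector. *)
  pose w : 'rV[R]_q := delta_mx 0 (Ordinal hq).
  have hw : \sum_(j < q) w ord0 j ^+ 2 = 1.
    rewrite (bigD1 (Ordinal hq))//= big1 ?addr0; first by rewrite mxE !eqxx expr1n.
    by move=> j /negPf j0; rewrite mxE j0 andbF expr0n.
  rewrite -(scale0r w) (CK_slice hv hw f0K) /eslice/=.
  have := ck_coef_eq0 A v w f0K (leq_pmull K (isT : 0 < 2)%N).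
  (* When the truncation bound is 0 the sum is empty, but then f_0 itself is zero. *)
  case: (2 * K)%N => [|N] F0.
    rewrite big_ord0; exact: (esym (congr1 (fun F : 'rV[R]_p.+1 -> 'rV[R]_d => F y) F0)).
  rewrite big_ord_recl/= big1 ?addr0; first by rewrite expr0 fact0 divr1 scale1r.
  by move=> n _; rewrite /bump/= expr0n/= mul0r scale0r.
split=> //; split.
  move=> w hw /=; rewrite CKE//; split; first exact: C1slice_ck.
  exact: slice_eq_ck.
move=> g gM g0; apply/funext => x.
pose y : 'rV[R]_p.+1 := lsubmx x; pose u : 'rV[R]_q := rsubmx x.
have -> : x = row_mx y u by rewrite hsubmxK.
pose S := \sum_(j < q) u ord0 j ^+ 2.
have S0 : 0 <= S by apply: sumr_ge0 => j _; exact: sqr_ge0.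
(* At r = 0 both functions equal f_0 by assumption; elsewhere x lies on the slice of its normalised
   component u / r, at positive radius. *)
have [SE|Sn0] := eqVneq S 0.
  have -> : u = 0; last by rewrite g0 CK0.
  apply/rowP => j; rewrite [RHS]mxE; apply/eqP.
  have /psumr_eq0P/(_ j isT)/eqP : S = 0 by []; rewrite sqrf_eq0; apply.
  by move=> k _; exact: sqr_ge0.
pose r := Num.sqrt S.
have r0 : 0 < r by rewrite sqrtr_gt0 lt_def Sn0.
pose w := r^-1 *: u.
have hw : \sum_(j < q) w ord0 j ^+ 2 = 1.
  under eq_bigr do rewrite mxE exprMn.
  by rewrite -mulr_sumr -/S exprVn sqr_sqrtr// mulVf.
have -> : u = r *: w by rewrite scalerA divff ?scale1r// gt_eqF.
have [C1 e1] := gM w hw.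
have := @slice_unique _ _ A _ _ v hv w hw _ _ C1 e1 (C1slice_ck A v w f0K) (slice_eq_ck hv hw f0K).
move=> /(_ _ y r r0) /= ->; first by rewrite (CK_slice hv hw f0K).
by move=> y'; rewrite -(CK_slice hv hw f0K) /= scale0r g0 CK0.
Qed.
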